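(* Let $\sigma$ be a proper primitive substitution such that $X_\sigma$ is a Cantor set. Then there exist countably infinitely many proper (primitive) substitutions $\zeta_n$, $n\ge1$, such that $(X_\sigma,T_\sigma)$ is orbit equivalent to $(X_{\zeta_n},T_{\zeta_n})$ for every $n$, but the systems $(X_{\zeta_n},T_{\zeta_n})$, $n\ge1$, are pairwise non-isomorphic.
   Context: A substitution on a finite alphabet $\mathcal A$ is a map $\sigma:\mathcal A\to\mathcal A^*$, where $\mathcal A^*$ is the set of finite non-empty words over $\mathcal A$; it extends to words by concatenation. It is primitive if there is $n$ such that for all $a,b\in\mathcal A$ the letter $b$ appears in $\sigma^n(a)$. It is proper if there exist an integer $n>0$ and two letters $a,b\in\mathcal A$ such that for every $c\in\mathcal A$, $a$ is the first letter and $b$ is the last letter of $\sigma^n(c)$. The language $L_\sigma$ is the set of all finite words occurring in $\sigma^n(a)$ for some $n\ge0$, $a\in\mathcal A$; $X_\sigma$ is the set of $x\in\mathcal A^{\mathbb Z}$ all of whose finite subwords lie in $L_\sigma$, and $T_\sigma$ is the restriction of the left shift to $X_\sigma$. All substitutions considered (including the $\zeta_n$) are primitive with $X_\sigma$ a Cantor set. The substitutions $\zeta_n$ may be defined on alphabets different from that of $\sigma$ and from one another. Minimal Cantor systems $(X,T)$ and $(Y,S)$ (homeomorphisms of Cantor spaces with all two-sided orbits dense) are isomorphic if there is a homeomorphism $h:X\to Y$ with $h\circ T=S\circ h$, and orbit equivalent if there is a homeomorphism $h:X\to Y$ with $h(\mathrm{Orb}_T(x))=\mathrm{Orb}_S(h(x))$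 for all $x\in X$, where $\mathrm{Orb}_T(x)=\{T^n(x):n\in\mathbb Z\}$. *)

(* Defs.v *)
From HB Require Import structures.
From mathcomp Require Import all_boot all_order all_algebra.
From mathcomp Require Import all_classical topology cantor.

Set Implicit Arguments.
Unset Strict Implicit.
Unset Printing Implicit Defensive.

Import GRing.Theory.

Local Open Scope classical_set_scope.
Local Open Scope ring_scope.

Lemma ptws_reindex_continuous (I : eqType) (K : topologicalType) (s : I -> I) :
  continuous (fun x : {ptws I -> K} => (fun i => x (s i)) : {ptws I -> K}).
Proof.
move=> x; apply/cvg_sup; first exact/fmap_filter/(nbhs_filter x).
move=> i; move: x.
apply/(@continuousP _ (initial_topology (@^~ i))) => V [W oW <-].
rewrite -[_ @^-1` _]/(proj (s i) @^-1` W).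
by apply: open_comp => // + _; exact: proj_continuous.
Qed.

Definition homeomorphism (X Y : topologicalType) (h : X -> Y) : Prop :=
  exists g : Y -> X,
    [/\ cancel h g, cancel g h, continuous h & continuous g].

(* Not the library's [cantor_like], which also holds of the empty space and of
   nonmetrizable spaces such as uncountable powers of [bool]. *)
Definition cantor_set (X : topologicalType) : Prop :=
  exists h : X -> cantor_space, homeomorphism h.

(* The inverse is part of the data so that integer iterates are definable. *)
Record system := System {
  carrier :> topologicalType;
  fwd : carrier -> carrier;
  bwd : carrier -> carrier;
  fwdK : cancel fwd bwd;
  bwdK : cancel bwd fwd;
  fwd_continuous : continuous fwd;
  bwd_continuous : continuous bwd }.

Definition iterz (S : system) (n : int) : S -> S :=
  match n with
  | Posz k => iter k (@fwd S)
  | Negz k => iter k.+1 (@bwd S)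
  end.

Definition orb (S : system) (x : S) : set S :=
  [set iterz n x | n in [set: int]].

Definition isomorphic (S S' : system) : Prop :=
  exists h : S -> S',
    homeomorphism h /\ forall x, h (fwd x) = fwd (h x).

Definition orbit_equivalent (S S' : system) : Prop :=
  exists h : S -> S',
    homeomorphism h /\ forall x, h @` orb x = orb (h x).

Record substitution (A : finType) := Substitution {
  image_word :> A -> seq A;
  image_word_neq0 : forall a, image_word a != [::] }.

Section Substitution.
Context {A : finType}.
Implicit Type sigma : substitution A.

Definition subst_word sigma (w : seq A) : seq A := flatten (map sigma w).

Definition subst_iter sigma (n : nat) (a : A) : seq A :=
  iter n (subst_word sigma) [:: a].

Definition primitive_subst sigma : Prop :=
  exists n : nat, forall a b : A, b \in subst_iter sigma n a.

Definition proper_subst sigma : Prop :=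
  exists (n : nat) (a b : A), (0 < n)%N /\
    forall c : A, prefix [:: a] (subst_iter sigma n c) /\
                  suffix [:: b] (subst_iter sigma n c).

Definition language sigma : set (seq A) :=
  [set w | exists (n : nat) (a : A), infix w (subst_iter sigma n a)].

Local Notation full_shift := {ptws int -> discrete_topology A}.

Definition subword (x : full_shift) (i : int) (k : nat) : seq A :=
  mkseq (fun j => x (i + j%:Z)) k.

Definition subst_shift sigma : set full_shift :=
  [set x | forall (i : int) (k : nat), language sigma (subword x i k)].

Definition shiftz (d : int) (x : full_shift) : full_shift :=
  fun i => x (i + d).

Lemma shiftz_continuous d : continuous (shiftz d).
Proof. exact: (@ptws_reindex_continuous int (discrete_topology A) (+%R^~ d)). Qed.

Lemma shiftz_subst_shift sigma d x :
  x \in subst_shift sigma -> shiftz d x \in subst_shift sigma.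
Proof.
rewrite !inE => xX i k; have := xX (i + d) k.
by congr (language _ _); apply: eq_mkseq => j; rewrite /shiftz addrAC.
Qed.

Definition sub_shiftz sigma d (x : subst_shift sigma) : subst_shift sigma :=
  exist _ (shiftz d (\val x)) (shiftz_subst_shift d (valP x)).

Lemma sub_shiftzK sigma d d' : d + d' = 0 ->
  cancel (@sub_shiftz sigma d) (@sub_shiftz sigma d').
Proof.
move=> dd x; apply: val_inj; apply: funext => i /=.
by rewrite /shiftz -addrA [d' + d]addrC dd addr0.
Qed.

Lemma sub_shiftz_continuous sigma d : continuous (@sub_shiftz sigma d).
Proof.
apply: (@continuous_comp_initial _ _ _ set_val) => x.
apply: (@continuous_comp _ _ _ (set_val : subst_shift sigma -> _) (shiftz d)).
  exact: initial_continuous.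
exact: shiftz_continuous.
Qed.

Definition subst_system sigma : system :=
  @System (subst_shift sigma) (@sub_shiftz sigma 1) (@sub_shiftz sigma (-1))
    (sub_shiftzK (addrN 1)) (sub_shiftzK (addNr 1))
    (@sub_shiftz_continuous sigma 1) (@sub_shiftz_continuous sigma (-1)).

End Substitution.

(* Main.v *)
(* Proof idea. Being primitive and aperiodic, sigma has bounded powers. Hence,
   for the patterns sigma^k(b).sigma^k(a) around the origin of its fixed point,
   the derived sequences (codings by return words) take finitely many values up
   to renaming (Durand). Two levels with the same derived sequence give a proper
   primitive substitution tau on return words such that X_sigma is a tower over
   X_tau with floor word theta, and the decompositions by theta and by tau are
   recognizable since their cuts are occurrences of the patterns. Thus X_sigma is
   the path space of an ordered Bratteli diagram, and two points share an orbit
   iff their paths are cofinal, or one is cofinal to the minimal and the other to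
   the maximal path. Rearranging the interior letters of each tau(c) changes the
   order of the diagram but not this relation. The letters are rearranged so that
   every image starts with the marker (al d)^M, which keeps the substitution
   recognizable and puts M-th powers of arbitrarily long words in its language;
   the tower over it is again a substitution subshift zeta. As each zeta has
   bounded powers while M is arbitrary, infinitely many of these orbit equivalent
   systems are pairwise non-isomorphic. *)

Require Import Defs.
From mathcomp Require Import all_boot all_order all_algebra.
From mathcomp Require Import all_classical topology.
From mathcomp Require Import cantor zify.

Set Implicit Arguments.
Unset Strict Implicit.
Unset Printing Implicit Defensive.

Import Order.TTheory GRing.Theory Num.Theory.

(** Recognizability is obtained four times, for [theta], [tau], the rearranged substitution and the
    floors of the tower, by one argument: a word that is irreducible for a pattern cannot be cut at
    a place where the pattern is visible on both sides, and visibility depends on the sequence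
    alone. Rearranging destroys the return words that supplied the pattern for [tau]; the marker is
    the substitute. It costs letters: an image must spell the marker, a label that keeps the images
    distinct, and a remainder that cannot imitate the marker. The cost depends on the number of
    return words, and the tower needs images at least as long as the return words, so [R] and
    [theta] are fixed before the multiplicity of letters is prescribed: the lower level stays, only
    the upper one is pushed upwards. Boundary letters never move, since the order of the diagram
    enters the orbit relation only through extremal edges. The tower uses one fresh symbol per floor
    because a substitution acts on letters: the image of a column can then be shared out among its
    floors. Columns as high as the words of [theta] are long make the bottom positions on both sides
    correspond. *)

Definition mor {S T : Type} (f : S -> seq T) (w : seq S) : seq T :=
  flatten (map f w).

(** * Morphisms of free monoids *)

Section Morphism.
Context {S T : Type}.
Implicit Types (f : S -> seq T) (w : seq S).

Lemma mor_cons f x w : mor f (x :: w) = f x ++ mor f w. Proof. by []. Qed.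

Lemma mor1 f x : mor f [:: x] = f x. Proof. by rewrite /mor /= cats0. Qed.

Lemma mor_cat f u v : mor f (u ++ v) = mor f u ++ mor f v.
Proof. by rewrite /mor map_cat flatten_cat. Qed.

Lemma eq_mor f g w : f =1 g -> mor f w = mor g w.
Proof. by move=> fg; rewrite /mor (eq_map fg). Qed.

Lemma size_mor_ge f K w : (forall x, K <= size (f x)) ->
  size w * K <= size (mor f w).
Proof.
move=> Kf; elim: w => //= x w IH.
by rewrite mor_cons size_cat mulSn leq_add.
Qed.

Lemma size_mor_le f K w : (forall x, size (f x) <= K) ->
  size (mor f w) <= size w * K.
Proof.
move=> Kf; elim: w => //= x w IH.
by rewrite mor_cons size_cat mulSn leq_add.
Qed.

Lemma mor_split f w t : t < size (mor f w) ->
  exists w1 x w2, w = w1 ++ x :: w2 /\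
    size (mor f w1) <= t < size (mor f w1) + size (f x).
Proof.
elim: w t => //= x w IH t; rewrite mor_cons size_cat => tlt.
have [tx|xt] := ltnP t (size (f x)); first by exists [::], x, w; rewrite /= tx.
have [|w1 [y [w2 [-> wt]]]] := IH (t - size (f x)); first lia.
by exists (x :: w1), y, w2; split=> //; rewrite mor_cons size_cat; lia.
Qed.

End Morphism.

Lemma mor_comp {S T U : Type} (f : S -> seq T) (g : T -> seq U) w :
  mor g (mor f w) = mor (mor g \o f) w.
Proof. by elim: w => //= x w IH; rewrite !mor_cons mor_cat IH. Qed.

Lemma mor_id {S : Type} (w : seq S) : mor (fun c => [:: c]) w = w.
Proof. by elim: w => //= x w IH; rewrite mor_cons IH. Qed.

Section EqMorphism.
Context {S T : eqType}.
Implicit Types (f : S -> seq T) (w : seq S).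

Lemma infix_mor f u v : infix u v -> infix (mor f u) (mor f v).
Proof. by case/infixP=> p [q ->]; rewrite !mor_cat infix_infix. Qed.

Lemma prefix_mor f u v : prefix u v -> prefix (mor f u) (mor f v).
Proof. by case/prefixP=> p ->; rewrite !mor_cat prefix_prefix. Qed.

Lemma suffix_mor f u v : suffix u v -> suffix (mor f u) (mor f v).
Proof. by case/suffixP=> p ->; rewrite !mor_cat suffix_suffix. Qed.

Lemma infix_mor_mem f x w : x \in w -> infix (f x) (mor f w).
Proof. by case/splitPr=> u v; rewrite mor_cat mor_cons infix_infix. Qed.

Lemma mem_mor f w y : reflect (exists2 x, x \in w & y \in f x) (y \in mor f w).
Proof. exact: flatten_mapP. Qed.

Lemma cat_eq_le (a b p q : seq T) : a ++ b = p ++ q -> size a <= size p ->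
  exists r, p = a ++ r /\ b = r ++ q.
Proof.
move=> e ap; exists (drop (size a) p).
have ea : take (size a) p = a.
  by rewrite -(takel_cat q ap) -e take_size_cat.
split; first by rewrite -{1}ea cat_take_drop.
have := congr1 (drop (size a)) e; rewrite drop_size_cat // drop_cat => ->.
case: ltngtP ap => // eap _; rewrite eap subnn drop0 drop_oversize //.
Qed.

(** The block in which [v] starts ends after at most [K] letters of [v], and the next block fits
    into the remaining [K]. *)
Lemma long_infix_block f K v w : (forall x, size (f x) <= K) ->
  0 < size v -> 2 * K <= size v -> infix v (mor f w) ->
  exists2 x, x \in w & infix (f x) v.
Proof.
move=> fK v0 Kv; elim: w => [|x w IH].
  by rewrite infixs0 => /eqP v_nil; rewrite v_nil in v0.
case/infixP=> p [q]; rewrite mor_cons => e; have sx := fK x.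
have [xp|px] := leqP (size (f x)) (size p).
  have [r [_ e']] := cat_eq_le e xp.
  have /IH[y yw vy] : infix v (mor f w) by rewrite e' infix_infix.
  by exists y; rewrite // inE yw orbT.
have [r [er e']] := cat_eq_le (esym e) (ltnW px).
have sr : size r <= K by move: sx; rewrite er size_cat; lia.
have [|v' [ev e'']] := cat_eq_le (esym e'); first lia.
have sv' : size v = size r + size v' by rewrite ev size_cat.
case: w IH {e e'} e'' => [|y w] _ e''.
  by move: (congr1 size e''); rewrite size_cat /=; lia.
exists y; first by rewrite !inE eqxx orbT.
have sy := fK y; move: e''; rewrite mor_cons => e''.
have [|s [ev' _]] := cat_eq_le e''; first lia.
by rewrite ev ev' infix_infix.
Qed.

(** The extra letter in [K.+1] is the worst case: one letter of [v] in the first block and [K] in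
    the second. *)
Lemma short_infix_blocks f K v w : (forall x, K <= size (f x)) ->
  0 < size v -> size v <= K.+1 -> 1 < size w -> infix v (mor f w) ->
  exists x y, infix [:: x; y] w /\ infix v (f x ++ f y).
Proof.
move=> fK v0 vK; elim: w => [|x [|y w] IH] // _.
case/infixP=> p [q]; rewrite !mor_cons => e.
have sx := fK x; have sy := fK y.
have [|] := leqP (size p + size v) (size (f x) + size (f y)) => pv.
  exists x, y; split; first exact: (infix_infix [::] [:: x; y] w).
  move: e; rewrite !catA => /esym e.
  have [|r [er _]] := cat_eq_le e; first by rewrite !size_cat.
  by rewrite er infix_catr // suffixW // suffix_suffix.
have xp : size (f x) <= size p by lia.
have [r [_ e']] := cat_eq_le e xp.
case: w IH e e' => [|z w] IH e e'.
  by move: (congr1 size e); rewrite !size_cat /=; lia.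
have [//||x' [y' [xy' vxy']]] := IH.
  by rewrite mor_cons e' infix_infix.
exists x', y'; split=> //; exact: (@infix_catl _ _ _ [:: x]).
Qed.

End EqMorphism.

Section Iterate.
Context {S : Type}.
Implicit Types (f : S -> seq S) (w : seq S).

Definition itmor f n w := iter n (mor f) w.

Lemma itmor_cat f n u v : itmor f n (u ++ v) = itmor f n u ++ itmor f n v.
Proof. by elim: n => [//|n IH]; rewrite /itmor /= -!/(itmor f n _) IH mor_cat.
  Qed.

Lemma itmor_add f m n w : itmor f (m + n) w = itmor f m (itmor f n w).
Proof. exact: iterD. Qed.

Lemma itmorS f n w : itmor f n.+1 w = mor f (itmor f n w). Proof. by []. Qed.

Lemma itmorSr f n w : itmor f n.+1 w = itmor f n (mor f w). Proof.
  exact: iterSr. Qed.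

Lemma itmor_mor f n w : itmor f n w = mor (fun c => itmor f n [:: c]) w.
Proof.
elim: w => [|x w IH]; last by rewrite mor_cons -cat1s itmor_cat -IH.
by elim: n => [//|n IH]; rewrite itmorS IH.
Qed.

End Iterate.
Arguments itmor : simpl never.

Section EqIterate.
Context {S : eqType}.
Implicit Types (f : S -> seq S) (w : seq S).

Lemma infix_itmor f n u v : infix u v -> infix (itmor f n u) (itmor f n v).
Proof. by case/infixP=> p [q ->]; rewrite !itmor_cat infix_infix. Qed.

Lemma prefix_itmor f n u v : prefix u v -> prefix (itmor f n u) (itmor f n v).
Proof. by case/prefixP=> p ->; rewrite !itmor_cat prefix_prefix. Qed.

Lemma suffix_itmor f n u v : suffix u v -> suffix (itmor f n u) (itmor f n v).
Proof. by case/suffixP=> p ->; rewrite !itmor_cat suffix_suffix. Qed.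

(* The boundary letters make [f] proper; that the interior of every image
   contains all letters is a strong form of primitivity. *)
Definition full f (a b : S) :=
  forall c, exists s, f c = a :: rcons s b /\ forall d, d \in s.

Definition itlang f w := exists n c, infix w (itmor f n [:: c]).

Context {f : S -> seq S} {a b : S}.
Context (Hf : full f a b).

Lemma full_mem c d : d \in f c.
Proof. by have [s [-> sP]] := Hf c; rewrite inE mem_rcons inE sP !orbT. Qed.

Lemma full_size c : 2 < size (f c).
Proof. by have [[|x s] [-> /(_ c)]] //= := Hf c; rewrite size_rcons. Qed.

Lemma full_prefix w : w != [::] -> prefix [:: a] (mor f w).
Proof.
case: w => // c w _; rewrite mor_cons; have [s [-> _]] := Hf c.
by rewrite /= eqxx prefix0s.
Qed.

Lemma full_suffix w : w != [::] -> suffix [:: b] (mor f w).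
Proof.
case/lastP: w => // w c _; rewrite -cats1 mor_cat mor1.
have [s [-> _]] := Hf c.
by rewrite -rcons_cons -cats1 catA suffix_suffix.
Qed.

Lemma size_itmor n w : size w * 2 ^ n <= size (itmor f n w).
Proof.
elim: n => [|n IH]; first by rewrite muln1.
rewrite itmorS; apply: leq_trans (size_mor_ge (K := 2) _ _); last first.
  by move=> c; have := full_size c; lia.
by rewrite expnS; lia.
Qed.

Lemma size_itmor_gt n w : w != [::] -> n < size (itmor f n w).
Proof.
rewrite -size_eq0 => w0; have := size_itmor n w;
  have : n < 2 ^ n by exact: ltn_expl.
by nia.
Qed.

Lemma itmor_neq0 n w : w != [::] -> itmor f n w != [::].
Proof. by move/(size_itmor_gt n); case: itmor. Qed.

Lemma itmor_mem n w d : w != [::] -> d \in itmor f n.+1 w.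
Proof.
move=> w0; have := itmor_neq0 n w0; rewrite itmorS; case: itmor => // c u _.
by rewrite mor_cons mem_cat full_mem.
Qed.

Lemma itmor_infix m n w c : w != [::] -> m < n ->
  infix (itmor f m [:: c]) (itmor f n w).
Proof.
move=> w0 mn; have -> : n = m + (n - m.+1).+1 by lia.
rewrite itmor_add; apply: infix_itmor.
by have /splitPr[u v] := itmor_mem (n - m.+1) c w0;
  exact: (infix_infix u [:: c] v).
Qed.

Lemma itmor_prefix m n w : w != [::] -> m < n ->
  prefix (itmor f m [:: a]) (itmor f n w).
Proof.
move=> w0 mn; have -> : n = m + (n - m.+1).+1 by lia.
by rewrite itmor_add; apply/prefix_itmor/full_prefix/itmor_neq0.
Qed.

Lemma itmor_suffix m n w : w != [::] -> m < n ->
  suffix (itmor f m [:: b]) (itmor f n w).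
Proof.
move=> w0 mn; have -> : n = m + (n - m.+1).+1 by lia.
by rewrite itmor_add; apply/suffix_itmor/full_suffix/itmor_neq0.
Qed.

Lemma itlang_large w : itlang f w ->
  exists N, forall n u, N <= n -> u != [::] -> infix w (itmor f n u).
Proof.
case=> n [c wc]; exists n.+1 => m u nm u0.
exact: infix_trans wc (itmor_infix c u0 nm).
Qed.

End EqIterate.

(** * Bounded powers *)

Section PowerBound.
Context {S : finType} {f : S -> seq S} {a b : S}.
Context (Hf : full f a b).
Context (aperiodic : forall p, 0 < p ->
  exists2 v, itlang f v & size v = p.+1 /\ nth a v 0 != nth a v p).

Let Lam k := \max_(c : S) size (itmor f k [:: c]).
Let B := \max_(c : S) size (f c).

Lemma size_itmor_max k c : size (itmor f k [:: c]) <= Lam k.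
Proof. exact: (leq_bigmax c). Qed.

(** Every level [k] block occurs in every block one level up, so block lengths at neighbouring
    levels are comparable. *)
Lemma size_itmor_min k c : Lam k <= size (itmor f k.+1 [:: c]).
Proof. by apply/bigmax_leqP => d _; apply/size_infix/(itmor_infix Hf). Qed.

Lemma Lam_growth g k : Lam (k + g) <= B ^ g * Lam k.
Proof.
elim: g => [|g IH]; first by rewrite addn0 mul1n.
rewrite addnS; apply/bigmax_leqP => c _.
rewrite itmorSr mor1 itmor_mor; apply: leq_trans (size_mor_le _ (size_itmor_max
  _)) _.
rewrite expnS -mulnA leq_mul //; exact: (leq_bigmax c).
Qed.

Lemma Lam_gt k : k < Lam k.
Proof. by apply: leq_trans (size_itmor_gt Hf k _) (size_itmor_max k a). Qed.

Lemma itlang_pairs : exists g, forall d d' c,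
  itlang f [:: d; d'] -> infix [:: d; d'] (itmor f g [:: c]).
Proof.
have /fin_all_exists[g gP] : forall dd : S * S, exists n, forall m c, n <= m ->
    itlang f [:: dd.1; dd.2] -> infix [:: dd.1; dd.2] (itmor f m [:: c]).
  move=> [d d'] /=; have [dd|ndd] := pselect (itlang f [:: d; d']).
    have [N NP] := itlang_large Hf dd; exists N => m c Nm _; exact: NP.
  by exists 0 => m c _ /ndd.
exists (\max_dd g dd) => d d' c dd.
by apply: (gP (d, d')) => //; exact: (leq_bigmax (d, d')).
Qed.

(** A witness [v] against period [p] has length [p.+1], so it fits into two consecutive blocks of a
    level whose blocks have at least [p] letters, and this pair of blocks occurs in every block [g]
    levels higher. A long word with period [p] would contain such a block, hence [v]. *)
Lemma power_bound : exists N, forall p w, 0 < p -> itlang f w ->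
  (forall i, i + p < size w -> nth a w (i + p) = nth a w i) -> size w < N * p.
Proof.
have [g gP] := itlang_pairs.
have B0 : 0 < B.
  by apply: leq_trans (leq_bigmax a); apply: leq_trans (full_size Hf a).
(* One factor [B] bounds the first [Lam k0] above [p] by [B * p], [g.+1] more lead to level
   [k0.+1 + g], and the [2] ensures that [w] contains a whole block of that level. *)
exists (2 * B ^ (g.+2)) => p w p0 wL wp; rewrite ltnNge; apply/negP => wlong.
have /ex_minnP[k0 pk0 k0min] : exists k, p <= Lam k.
  by exists p; exact/ltnW/Lam_gt.
have k0p : Lam k0 <= B * p.
  case: k0 pk0 k0min => [_ _|k pk /(_ k)].
    have : Lam 0 <= 1 by apply/bigmax_leqP.
    by move=> L0; apply: leq_trans L0 _; rewrite muln_gt0 B0.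
  rewrite -addn1 => kmin; apply: leq_trans (Lam_growth 1 k) _.
  by rewrite expn1 leq_mul2l; apply/orP; right; case: leqP kmin => // ? ?; lia.
have [v vL [sv vN]] := aperiodic p0.
set k := k0.+1.
have [N NP] := itlang_large Hf wL.
have wB : infix w (itmor f (k + g) (itmor f N [:: a])).
  by rewrite -itmor_add addnC; apply: NP => //; lia.
rewrite itmor_mor in wB.
have [||c _ cw] := long_infix_block (size_itmor_max (k + g)) _ _ wB.
- have : 0 < B ^ g.+2 by rewrite expn_gt0 B0.
  by move: wlong; set X := B ^ _; nia.
- apply: leq_trans wlong.
  rewrite /k addSnnS -mulnA leq_mul //; apply: leq_trans (Lam_growth _ _) _.
  by rewrite [B ^ g.+2]expnSr -mulnA leq_mul.
have vw : infix v w.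
  have [M MP] := itlang_large Hf vL.
  have : infix v (itmor f (k + M.+1) [:: a]) by apply: MP => //; lia.
  rewrite itmor_add itmor_mor => vB.
  have [|||d [d' [dd vdd]]] := short_infix_blocks (size_itmor_min k0) _ _ _ vB.
  - by rewrite sv.
  - by rewrite sv ltnS.
  - by apply: leq_trans (size_itmor_gt Hf M.+1 _).
  apply: (infix_trans _ cw); rewrite itmor_add.
  apply: (@infix_trans _ (itmor f k [:: d; d'])).
    by rewrite -cat1s itmor_cat.
  apply/infix_itmor/gP; exists M.+1, a.
  exact: dd.
case/infixP: vw => x [y ew].
have vE i : i <= p -> nth a w (size x + i) = nth a v i.
  move=> ip; rewrite ew nth_cat ltnNge leq_addr addKn nth_cat sv ltnS.
  by rewrite ip.
have := wp (size x); rewrite vE // -[X in _ = nth a w X]addn0 vE //.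
move=> vp; move: vN; rewrite vp ?eqxx //.
by rewrite ew !size_cat sv; lia.
Qed.

End PowerBound.

(** * Return words *)

Section Good.
Context {A : eqType} (ul ur : seq A).
Implicit Types p u v w : seq A.

Lemma prefix_catl_size (u x y : seq A) :
  prefix u (x ++ y) -> size u <= size x -> prefix u x.
Proof. by rewrite !prefixE => + ux; rewrite takel_cat. Qed.

Lemma suffix_catr_size (u x y : seq A) :
  suffix u (x ++ y) -> size u <= size y -> suffix u y.
Proof.
rewrite -!prefix_rev rev_cat => /prefix_catl_size + uy.
by apply; rewrite !size_rev.
Qed.

Lemma cat_eq_ge (x y p q : seq A) : x ++ y = p ++ q -> size y <= size q ->
  exists r, q = r ++ y /\ x = p ++ r.
Proof.
move=> e yq; have [|r [-> ->]] := cat_eq_le (esym e); last by exists r.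
by have := congr1 size e; rewrite !size_cat; lia.
Qed.

(* In a text where [w] stands between [ul] and [ur], both ends of [w] are
   centres of occurrences of [ul ++ ur]; the irreducible good words are the
   return words to this pattern. *)
Definition good w := prefix ur (w ++ ur) && suffix ul (ul ++ w).

Lemma good_nil : good [::].
Proof. by rewrite /good cats0 prefix_refl suffix_refl. Qed.

Lemma prefix_ur_cat u v : prefix ur (u ++ ur) -> prefix ur (v ++ ur) ->
  prefix ur (u ++ v ++ ur).
Proof.
by move=> + /prefixP[t ->] => /prefixP[t' e];
  rewrite catA e -catA prefix_prefix.
Qed.

Lemma suffix_ul_cat u v : suffix ul (ul ++ u) -> suffix ul (ul ++ v) ->
  suffix ul ((ul ++ u) ++ v).
Proof.
by move=> /suffixP[t ->] /suffixP[t' e]; rewrite -catA e catA suffix_suffix.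
Qed.

Lemma good_cat u v : good u -> good v -> good (u ++ v).
Proof.
case/andP=> pu su /andP[pv sv].
by rewrite /good -catA prefix_ur_cat //= catA suffix_ul_cat.
Qed.

(** The pattern seen at the middle cut is what each half needs beyond its inner end; only lengths
    remain to be compared. *)
Lemma good_split u v : good (u ++ v) ->
  prefix ur (v ++ ur) -> suffix ul (ul ++ u) -> good u /\ good v.
Proof.
case/andP=> puv suv pv su; rewrite /good pv su andbT; split=> /=.
- move: puv; case/prefixP: pv => t e; rewrite -catA e catA.
  by move/prefix_catl_size; apply; rewrite size_cat leq_addl.
- move: suv; case/suffixP: su => t e; rewrite catA e -catA.
  by move/suffix_catr_size; apply; rewrite size_cat leq_addr.
Qed.

Definition irred p := [/\ p != [::], good p &
  forall s1 s2, p = s1 ++ s2 -> s1 != [::] -> s2 != [::] ->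
    ~ (good s1 /\ good s2)].

(** Irreducible words followed by [ur] form a prefix code: the end of the shorter one would cut the
    longer one into two good words. *)
Lemma irred_first p p' Y : irred p -> irred p' ->
  prefix (p ++ ur) Y -> prefix (p' ++ ur) Y -> p = p'.
Proof.
wlog pp' : p p' / size p <= size p'.
  move=> W ip ip' pY p'Y; case: (leqP (size p) (size p')) => [|/ltnW] pp'.
    exact: W.
  by apply: esym; apply: W.
move=> [p0 gp _] [_ gp' ip'] /prefixP[s ->] /prefixP[s' e].
rewrite -!catA in e; have [w [ep' e']] := cat_eq_le e pp'.
case: w ep' e' => [|x w] ep' e'; first by rewrite ep' cats0.
case: (ip' _ _ ep') => //; apply: good_split; rewrite -?ep' //.
- apply: (@prefix_catl_size _ _ s'); last by rewrite size_cat leq_addl.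
  by rewrite -catA -e' prefix_prefix.
- by case/andP: gp.
Qed.

Lemma irred_last p p' Y : irred p -> irred p' ->
  suffix (ul ++ p) Y -> suffix (ul ++ p') Y -> p = p'.
Proof.
wlog pp' : p p' / size p <= size p'.
  move=> W ip ip' pY p'Y; case: (leqP (size p) (size p')) => [|/ltnW] pp'.
    exact: W.
  by apply: esym; apply: W.
move=> [p0 gp _] [_ gp' ip'] /suffixP[s ->] /suffixP[s' e].
rewrite !catA in e; have [w [ep' e']] := cat_eq_ge e pp'.
case: w ep' e' => [|x w] ep' e'; first by rewrite ep'.
case: (ip' _ _ ep') => //; apply: good_split; rewrite -?ep' //.
- by case/andP: gp.
- apply: (@suffix_catr_size _ s'); last by rewrite size_cat leq_addr.
  by rewrite catA -e' suffix_suffix.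
Qed.

Lemma good_factor w : good w ->
  exists s, (forall p, p \in s -> irred p) /\ flatten s = w.
Proof.
have [n] := ubnP (size w); elim: n w => // n IH w wn gw.
have [->|w0] := eqVneq w [::]; first by exists [::].
case: (pselect (irred w)) => [iw|niw].
  by exists [:: w]; rewrite /= cats0; split=> // p; rewrite inE => /eqP ->.
have [s1 [s2 [ew s10 s20 g1 g2]]] : exists s1 s2,
    [/\ w = s1 ++ s2, s1 != [::], s2 != [::], good s1 & good s2].
  apply: contrapT => H; apply: niw; split=> // s1 s2 ew s10 s20 [g1 g2].
  by apply: H; exists s1, s2.
rewrite -!size_eq0 in s10 s20; move: wn; rewrite ew size_cat => wn.
have [|t1 [t1P e1]] := IH s1 _ g1; first lia.
have [|t2 [t2P e2]] := IH s2 _ g2; first lia.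
exists (t1 ++ t2); rewrite flatten_cat e1 e2; split=> // p.
by rewrite mem_cat => /orP[/t1P|/t2P].
Qed.

Lemma good_flatten s : (forall p, p \in s -> good p) -> good (flatten s).
Proof.
elim: s => [|p s IH] sP; first exact: good_nil.
apply: good_cat; first by rewrite sP ?mem_head.
by apply: IH => q qs; rewrite sP // inE qs orbT.
Qed.

(** The remainder after the first factor is good and so shows [ur]; hence [irred_first] determines
    that factor. *)
Lemma factor_uniq s s' : (forall p, p \in s -> irred p) ->
  (forall p, p \in s' -> irred p) -> flatten s = flatten s' -> s = s'.
Proof.
have headP p t : (forall q, q \in p :: t -> irred q) ->
    prefix (p ++ ur) (flatten (p :: t) ++ ur).
  move=> tP; rewrite /= -catA.
  have /andP[/prefixP[u ->] _] : good (flatten t).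
    apply: good_flatten => q qt.
    by have [] := tP q; rewrite // inE qt orbT.
  by rewrite catA prefix_prefix.
elim: s s' => [|p s IH] [|p' s'] //= sP s'P e.
- have [] := s'P p' (mem_head _ _).
  by move/(congr1 size): e; rewrite size_cat /=; case: p' {s'P} => //=.
- have [] := sP p (mem_head _ _).
  by move/(congr1 size): e; rewrite size_cat /=; case: p {sP} => //=.
have pp' : p = p'.
  apply: (@irred_first _ _ (flatten (p :: s) ++ ur)).
  - exact: sP (mem_head _ _).
  - exact: s'P (mem_head _ _).
  - exact: headP.
  - by rewrite /= e; apply: (headP _ _ s'P).
rewrite -pp' in e *; congr cons; apply: IH => [q qs|q qs|].
- by apply: sP; rewrite inE qs orbT.
- by apply: s'P; rewrite inE qs orbT.
- by move/eqP: e; rewrite eqseq_cat // => /andP[_ /eqP].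
Qed.

End Good.

Lemma infinite_pigeonhole (T : finType) (P : nat -> T -> Prop) :
  (forall k, exists v, P k v) -> exists v, forall n, exists2 k, n <= k & P k v.
Proof.
move=> PP; apply: contrapT => H.
have /fin_all_exists[g gP] : forall v, exists n, forall k, n <= k -> ~ P k v.
  move=> v; apply: contrapT => Hv; apply: H; exists v => n.
  apply: contrapT => Hn; apply: Hv; exists n => k nk Pk.
  by apply: Hn; exists k.
have [v] := PP (\max_v g v); apply: gP; exact: (leq_bigmax v).
Qed.

(** The language of the image under [theta] of the subshift of [tau], the common form in which the
    given subshift and the new ones are described. *)
Definition codelang (R S : eqType) (tau : R -> seq R) (theta : R -> seq S) w :=
  exists n c, infix w (mor theta (itmor tau n [:: c])).

Section Derived.
Context {S : finType} {f : S -> seq S} {a b : S}.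
Context (Hf : full f a b).
Context {N : nat}.
Context (HN : forall p w, 0 < p -> itlang f w ->
  (forall i, i + p < size w -> nth a w (i + p) = nth a w i) -> size w < N * p).

Let ul k := itmor f k [:: b].
Let ur k := itmor f k [:: a].

Lemma ur_mono k k' : k <= k' -> prefix (ur k) (ur k').
Proof.
by rewrite leq_eqVlt => /orP[/eqP->|kk']; [exact: prefix_refl|exact:
  (itmor_prefix Hf)].
Qed.

Lemma ul_mono k k' : k <= k' -> suffix (ul k) (ul k').
Proof.
by rewrite leq_eqVlt => /orP[/eqP->|kk']; [exact: suffix_refl|exact:
  (itmor_suffix Hf)].
Qed.

Lemma good_level k w : good (ul k) (ur k) (itmor f k.+1 w).
Proof.
have [->|w0] := eqVneq w [::].
  by rewrite itmor_mor; apply: good_nil.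
apply/andP; split.
- by apply/prefix_catl/(itmor_prefix Hf).
- by apply/suffix_catr/(itmor_suffix Hf).
Qed.

Lemma good_mono k k' w : k <= k' ->
  good (ul k') (ur k') w -> good (ul k) (ur k) w.
Proof.
move=> kk' /andP[p s]; apply/andP; split.
- have /prefixP[t e] := ur_mono kk'.
  apply: (@prefix_catl_size _ _ _ t); last by rewrite size_cat leq_addl.
  by rewrite -catA -e; apply: prefix_trans p; apply: ur_mono.
- have /suffixP[t e] := ul_mono kk'.
  apply: (@suffix_catr_size _ _ t); last by rewrite size_cat leq_addr.
  by rewrite catA -e; apply: suffix_trans s; apply: ul_mono.
Qed.

(** A good word moves [ur k] onto itself, so [ur k] has period [size p] and bounded powers apply:
    return words are not much shorter than the pattern. *)
Lemma good_long k p : p != [::] -> good (ul k) (ur k) p ->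
  size (ur k) < N * size p.
Proof.
move=> p0 /andP[/prefixP[t e] _]; apply: HN.
- by case: p p0 {e}.
- by exists k, a; apply: infix_refl.
- move=> i ip; have := congr1 (fun w => nth a w (i + size p)) e => /=.
  by rewrite !nth_cat ip ltnNge leq_addl /= addnK.
Qed.

Let B := \max_(c : S) size (f c).

Lemma size_level k c : size (itmor f k.+1 [:: c]) <= B ^ 2 * size (ur k).
Proof.
case: k => [|k].
  rewrite muln1 itmorS mor1 expnS expn1.
  have cB : size (f c) <= B by exact: (leq_bigmax c).
  apply: (leq_trans cB); rewrite leq_pmulr //.
  by apply: leq_trans cB; apply: leq_trans (full_size Hf c).
apply: leq_trans (size_itmor_max k.+2 c) _.
have := Lam_growth (f := f) 2 k; rewrite addn2 => /leq_trans; apply.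
by rewrite leq_mul2l; apply/orP; right; apply: size_itmor_min Hf _ _.
Qed.

(** Each factor has at least an [N]-th of the length of [ur k], which [size_level] compares with the
    whole block. The bound is the same for all [k]. *)
Lemma level_factor k c : exists s,
  [/\ forall p, p \in s -> irred (ul k) (ur k) p,
      flatten s = itmor f k.+1 [:: c] & size s <= N * B ^ 2].
Proof.
have [s [sP es]] := good_factor (good_level k [:: c]); exists s; split=> //.
have : size s * size (ur k) <= N * size (flatten s).
  elim: s sP {es} => //= p s IH sP; rewrite size_cat mulnDr mulSn leq_add //.
    by have [p0 gp _] := sP p (mem_head _ _); apply/ltnW/good_long.
  by apply: IH => q qs; apply: sP; rewrite inE qs orbT.
have := size_level k c; rewrite es => sl se.
have u0 : 0 < size (ur k) by apply: leq_ltn_trans (size_itmor_gt Hf k _).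
rewrite -(leq_pmul2r u0); apply: leq_trans se _.
by rewrite -mulnA leq_mul2l sl orbT.
Qed.

(* The words over [R] are the derived words at level [k] up to renaming of the
   return words; there are finitely many, so one pattern recurs. *)
Lemma derived_words : exists (R : finType) (phi : S -> seq R),
  (forall r, exists c, r \in phi c) /\
  forall n, exists2 k, n <= k & exists theta : R -> seq S,
    [/\ injective theta, forall r, irred (ul k) (ur k) (theta r) &
        forall c, mor theta (phi c) = itmor f k.+1 [:: c]].
Proof.
set D := N * B ^ 2; pose E := #|S| * D.
(* The finitely many values: a number [s.+1] of return words and, for each letter, a word of at most
   [D] of their numbers. *)
pose P k (v : {s : 'I_E & {ffun S -> D.-bseq 'I_s.+1}}) :=
  (forall r, exists c, r \in (tagged v c : seq _)) /\
  exists theta : 'I_(tag v).+1 -> seq S,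
    [/\ injective theta, forall r, irred (ul k) (ur k) (theta r) &
        forall c, mor theta (tagged v c) = itmor f k.+1 [:: c]].
have [|[s phi] vP] := @infinite_pigeonhole _ P; last first.
  exists 'I_s.+1, (fun c => phi c : seq _); split.
    by have [k _ [+ _]] := vP 0.
  by move=> n; have [k nk [_ kP]] := vP n; exists k.
move=> k; have /fin_all_exists[t tP] := level_factor k.
set U := undup (flatten [seq t c | c <- enum S]).
have UP p : reflect (exists c, p \in t c) (p \in U).
  rewrite mem_undup; apply: (iffP flatten_mapP) => [[c _ pc]|[c pc]].
    by exists c.
  by exists c; rewrite ?mem_enum.
have Uirr p : p \in U -> irred (ul k) (ur k) p.
  by case/UP=> c pc; have [+ _ _] := tP c; apply.
have UE : size U <= E.
  rewrite (leq_trans (size_undup _)) // /E cardE.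
  elim: (enum S) => //= c l IH; rewrite size_cat mulSn leq_add //.
  by have [] := tP c.
have U0 : 0 < size U.
  have : itmor f k.+1 [:: a] != [::] by apply: itmor_neq0 Hf _ _ _.
  have [_ <- _] := tP a; case eta: (t a) => [//|p l] _.
  have pU : p \in U by apply/UP; exists a; rewrite eta mem_head.
  by rewrite -has_predT; apply/hasP; exists p.
have [s sU] : exists s, size U = s.+1 by case: (size U) U0 => // s _; exists s.
have sE : s < E by rewrite -sU.
pose code p : 'I_s.+1 := inord (index p U).
pose theta (r : 'I_s.+1) := nth [::] U r.
have codeK p : p \in U -> theta (code p) = p.
  by move=> pU; rewrite /theta inordK ?nth_index // -sU index_mem.
have szb c : size (map code (t c)) <= D by rewrite size_map; have [] := tP c.
have thetaU r : theta r \in U by rewrite mem_nth // sU.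
have thetaK r : code (theta r) = r.
  by apply: val_inj; rewrite /= inordK index_uniq ?undup_uniq // sU.
exists (Tagged (fun s : 'I_E => {ffun S -> D.-bseq 'I_s.+1})
          (i := Ordinal sE) [ffun c => Bseq (szb c)]).
split=> /=.
  move=> r; have /UP[c rc] := thetaU r; exists c; rewrite ffunE /=.
  by apply/mapP; exists (theta r).
exists theta; split=> [|r|c].
- exact: can_inj thetaK.
- exact: Uirr.
- rewrite ffunE /= /mor -map_comp; have [_ <- _] := tP c; congr flatten.
  by rewrite -[RHS]map_id; apply/eq_in_map => p pc /=; apply/codeK/UP; exists c.
Qed.

End Derived.

(** * Substitutions on return words *)

Lemma leq_count_mor (S T : eqType) (f : S -> seq T) P w :
  (forall x, 0 < count P (f x)) -> size w <= count P (mor f w).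
Proof.
move=> fP; elim: w => //= x w IH; rewrite mor_cons count_cat.
by have := fP x; lia.
Qed.

Lemma leq_count_infix (T : eqType) P (u v : seq T) :
  infix u v -> count P u <= count P v.
Proof. by case/infixP=> p [q ->]; rewrite !count_cat; lia. Qed.

Lemma take_drop_infix (T : eqType) (w : seq T) i n : infix (take n (drop i w))
  w.
Proof.
by apply/infixP; exists (take i w), (drop n (drop i w)); rewrite !cat_take_drop.
Qed.

Section DerivedSubstitution.
Context {S : finType} {f : S -> seq S} {a b : S}.
Context (Hf : full f a b).
Context {N : nat}.
Context (HN : forall p w, 0 < p -> itlang f w ->
  (forall i, i + p < size w -> nth a w (i + p) = nth a w i) -> size w < N * p).
Context {R : finType} {phi : S -> seq R}.
Context (phi_onto : forall r, exists c, r \in phi c).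
Context {k : nat} {theta : R -> seq S}.
Let ul k := itmor f k [:: b].
Let ur k := itmor f k [:: a].
Context (theta_inj : injective theta).
Context (theta_irred : forall r, irred (ul k) (ur k) (theta r)).
Context (theta_phi : forall c, mor theta (phi c) = itmor f k.+1 [:: c]).

Lemma theta_mor_phi w : mor theta (mor phi w) = itmor f k.+1 w.
Proof. by rewrite mor_comp itmor_mor; apply: eq_mor => c; apply: theta_phi. Qed.

Lemma theta_mor_inj : injective (mor theta).
Proof.
move=> u v e; apply: (inj_map theta_inj); apply: factor_uniq e => p.
- by case/mapP=> r _ ->; apply: theta_irred.
- by case/mapP=> r _ ->; apply: theta_irred.
Qed.

Lemma good_theta w : good (ul k) (ur k) (mor theta w).
Proof.
by apply: good_flatten => p /mapP[r _ ->]; have [] := theta_irred r.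
Qed.

Lemma phi_neq0 c : phi c != [::].
Proof.
apply/eqP => pc; have := theta_phi c; rewrite pc /mor /= => e.
by have : itmor f k.+1 [:: c] != [::] by [apply: itmor_neq0 Hf _ _ _];
  rewrite -e.
Qed.

(** With a single return word, arbitrarily long iterates would be powers of it, against bounded
    powers. *)
Lemma two_letters (r : R) : exists d, d != r.
Proof.
apply: contrapT => H.
have Hr d : d = r by apply/eqP; apply: contraT => dr; case: H; exists d.
set p := size (theta r).
have p0 : 0 < p by have [+ _ _] := theta_irred r; rewrite -size_eq0 lt0n.
pose w := itmor f (k.+1 + N * p) [:: a].
have wl : N * p < size w.
  by apply: leq_ltn_trans (size_itmor_gt Hf (k.+1 + N * p) _) => //; lia.
have [v ew] : exists v, w = mor theta v.
  by exists (mor phi (itmor f (N * p) [:: a]));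
    rewrite theta_mor_phi -itmor_add.
suff : size w < N * p by lia.
apply: HN => //; first by exists (k.+1 + N * p), a; apply: infix_refl.
have swc u : theta r ++ mor theta u = mor theta u ++ theta r.
  elim: u => [|x u IH]; first by rewrite cats0.
  by rewrite mor_cons (Hr x) -catA IH.
case: v ew => [|x v]; first by move=> e; move: wl; rewrite e.
rewrite mor_cons (Hr x) => -> i ip.
rewrite nth_cat ltnNge leq_addl /= addnK swc nth_cat.
by move: ip; rewrite size_cat -/p addnC ltn_add2l => ->.
Qed.

Section Next.
Context {q : nat} {theta' : R -> seq S}.
Let k' := k + q.
Context (q2 : 1 < q).
Context (theta'_inj : injective theta').
Context (theta'_irred : forall r, irred (ul k') (ur k') (theta' r)).
Context (theta'_phi : forall c, mor theta' (phi c) = itmor f k'.+1 [:: c]).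

Lemma theta'_good w : good (ul k) (ur k) (mor theta' w).
Proof.
apply: (good_mono Hf (leq_addr q k)); apply: good_flatten => p /mapP[r _ ->].
by have [] := theta'_irred r.
Qed.

(** Cuts of the higher level are also cuts of the lower one, so unique factorization makes
    [theta' r] consist of whole factors of a text already decomposed by [theta]. *)
Lemma next_word r : exists2 u, mor theta u = theta' r &
  exists c, infix u (mor phi (itmor f q [:: c])).
Proof.
have [c rc] := phi_onto r; case/splitPr eqc: (phi c) / rc => [s1 s2].
have [t1 [t1P e1]] := good_factor (theta'_good s1).
have [t2 [t2P e2]] := good_factor (theta'_good s2).
have [t [tP e]] := good_factor (theta'_good [:: r]).
rewrite mor1 in e.
have et : t1 ++ t ++ t2 = map theta (mor phi (itmor f q [:: c])).
  apply: (@factor_uniq _ (ul k) (ur k)).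
  - by move=> p; rewrite !mem_cat => /or3P[/t1P|/tP|/t2P].
  - by move=> p /mapP[? _ ->]; apply: theta_irred.
  - rewrite !flatten_cat e1 e e2 -/(mor _ _) theta_mor_phi -itmor_add.
    by rewrite -[k.+1 + q]/(k'.+1) -theta'_phi eqc mor_cat mor_cons.
exists (take (size t) (drop (size t1) (mor phi (itmor f q [:: c])))).
  rewrite /mor map_take map_drop -et drop_size_cat // take_size_cat //.
by exists c; apply: take_drop_infix.
Qed.

Lemma next_substitution : exists2 tau : R -> seq R,
  forall r, mor theta (tau r) = theta' r &
  forall r, exists c, infix (tau r) (mor phi (itmor f q [:: c])).
Proof.
have /fin_all_exists2[tau tau1 tau2] := next_word.
by exists tau.
Qed.

Context {tau : R -> seq R}.
Context (theta_tau : forall r, mor theta (tau r) = theta' r).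
Context (tau_phi : forall r, exists c, infix (tau r) (mor phi (itmor f q [::
  c]))).

Lemma tau_neq0 r : tau r != [::].
Proof.
apply/eqP => e; have := theta_tau r; rewrite e => /esym e'.
by have [] := theta'_irred r; rewrite e'.
Qed.

Lemma tau_inj : injective tau.
Proof. by move=> r s e; apply: theta'_inj; rewrite -!theta_tau e. Qed.

(** Goodness makes [theta' r ++ ur k'] start with [ur k'], and so with the first return word of
    [f^(k+1)(a)], whatever [r] is. *)
Lemma tau_first r x : prefix [:: x] (phi a) -> prefix [:: x] (tau r).
Proof.
case/prefixP=> s /= es; have := tau_neq0 r.
case et : (tau r) => [//|y t] _; rewrite prefix_cons prefix0s andbT.
have /andP[/prefixP[v ev] _] : good (ul k') (ur k') (theta' r).
  by have [] := theta'_irred r.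
suff -> : x = y by [].
apply/theta_inj/(@irred_first _ (ul k) (ur k) _ _ (theta' r ++ ur k')) => //.
- rewrite ev; apply: prefix_catl.
  (* Because [q > 1], a letter follows [a]; its image supplies the [ur k] that must be visible
     behind the first return word. *)
  have [w w0 ew] : exists2 w, w != [::] & itmor f q.-1 [:: a] = a :: w.
    have : prefix [:: a] (itmor f q.-1 [:: a]).
      by apply: (@itmor_prefix _ _ _ _ Hf 0 q.-1 [:: a] isT); lia.
    case/prefixP=> w ew; exists w => //; apply/eqP => w0.
    have := size_itmor_gt Hf q.-1 (w := [:: a]) isT.
    by rewrite ew w0 /=; lia.
  have -> : ur k' = itmor f k.+1 [:: a] ++ itmor f k.+1 w.
    by rewrite -itmor_cat /= -ew -itmor_add; congr itmor; rewrite /k'; lia.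
  rewrite -theta_phi es mor_cons -catA.
  have /prefixP[w' ->] : prefix (ur k) (itmor f k.+1 w) by apply: (itmor_prefix
    Hf).
  have /andP[/prefixP[s' e] _] := good_theta s.
  by rewrite catA catA -[X in X ++ w']catA e -!catA catA prefix_prefix.
- rewrite -theta_tau et mor_cons -catA.
  have /prefixP[w' ->] : prefix (ur k) (ur k') by apply: (ur_mono Hf);
    rewrite leq_addr.
  have /andP[/prefixP[s' e] _] := good_theta t.
  by rewrite [mor theta t ++ _]catA e -!catA catA prefix_prefix.
Qed.

Lemma tau_last r x : suffix [:: x] (phi b) -> suffix [:: x] (tau r).
Proof.
case/suffixP=> s /= es; have := tau_neq0 r.
case/lastP et : (tau r) => [//|t y] _; rewrite -cats1.
have /andP[_ /suffixP[v ev]] : good (ul k') (ur k') (theta' r).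
  by have [] := theta'_irred r.
suff -> : x = y by apply: suffix_suffix.
apply/theta_inj/(@irred_last _ (ul k) (ur k) _ _ (ul k' ++ theta' r)) => //.
- rewrite ev; apply: suffix_catr.
  have [w w0 ew] : exists2 w, w != [::] & itmor f q.-1 [:: b] = w ++ [:: b].
    have : suffix [:: b] (itmor f q.-1 [:: b]).
      by apply: (@itmor_suffix _ _ _ _ Hf 0 q.-1 [:: b] isT); lia.
    case/suffixP=> w ew; exists w => //; apply/eqP => w0.
    have := size_itmor_gt Hf q.-1 (w := [:: b]) isT.
    by rewrite ew w0 /=; lia.
  have -> : ul k' = itmor f k.+1 w ++ itmor f k.+1 [:: b].
    by rewrite -itmor_cat /= -ew -itmor_add; congr itmor; rewrite /k'; lia.
  rewrite -theta_phi es mor_cat mor1 catA.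
  have /suffixP[w' ->] : suffix (ul k) (itmor f k.+1 w) by apply: (itmor_suffix
    Hf).
  have /andP[_ /suffixP[s' e]] := good_theta s.
  by rewrite -[(w' ++ _) ++ _]catA e -!catA !catA -catA suffix_suffix.
- rewrite -theta_tau et -cats1 mor_cat mor1 catA.
  have /suffixP[w' ->] : suffix (ul k) (ul k') by apply: (ul_mono Hf);
    rewrite leq_addr.
  have /andP[_ /suffixP[s' e]] := good_theta t.
  by rewrite -[(w' ++ _) ++ _]catA e -!catA !catA -catA suffix_suffix.
Qed.

(** Under [theta] both sides become [f^(k'+1)(c)]. This is where the two levels have to share the
    same [phi]. *)
Lemma tau_mor_phi c : mor tau (phi c) = mor phi (itmor f q [:: c]).
Proof.
apply: theta_mor_inj; rewrite theta_mor_phi -itmor_add mor_comp.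
by rewrite -[k.+1 + q]/(k'.+1) -theta'_phi; apply: eq_mor.
Qed.

Lemma itmor_tau_phi n w : itmor tau n (mor phi w) = mor phi (itmor f (n * q) w).
Proof.
elim: n => [//|n IH]; rewrite itmorS IH mor_comp mulSn itmor_add [itmor f q
  _]itmor_mor.
by rewrite mor_comp; apply: eq_mor => c; apply: tau_mor_phi.
Qed.

Lemma tau_codelang : (forall r, infix (phi a) (tau r)) ->
  forall w, itlang f w <-> codelang tau theta w.
Proof.
move=> tau_a w; split.
- case/(itlang_large Hf) => M MP.
  have := phi_neq0 a; case ea : (phi a) => [//|r t] _; exists M.+1, r.
  have : infix w (itmor f (k.+1 + M * q) [:: a]).
    by apply: MP => //; have : M <= M * q by [rewrite leq_pmulr //; lia]; lia.
  rewrite itmor_add -theta_mor_phi -itmor_tau_phi mor1 => /infix_trans; apply.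
  by rewrite itmorSr mor1; apply/infix_mor/infix_itmor/tau_a.
- case=> n [r wr]; have [c rc] := phi_onto r; exists (k.+1 + n * q), c.
  rewrite itmor_add -theta_mor_phi -itmor_tau_phi mor1.
  apply: infix_trans wr _; apply/infix_mor/infix_itmor.
  by have := infix_mor_mem (fun c => [:: c]) rc; rewrite mor_id.
Qed.

End Next.

End DerivedSubstitution.

(** The order of quantifiers matters: [R] and [theta] come from a lower level chosen before [Q], and
    only the upper level depends on [Q]. *)
Lemma derived_substitution (S : finType) (f : S -> seq S) (a b : S) :
  full f a b ->
  (forall p, 0 < p ->
     exists2 v, itlang f v & size v = p.+1 /\ nth a v 0 != nth a v p) ->
  exists (R : finType) (theta : R -> seq S) (ul ur : seq S),
    [/\ injective theta, forall r, irred ul ur (theta r),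
        forall r : R, exists d, d != r &
        forall Q, exists (tau : R -> seq R) (x y : R) (ul' ur' : seq S),
          [/\ full tau x y, forall c z, Q <= count_mem z (tau c),
              injective tau, forall r, irred ul' ur' (mor theta (tau r)) &
              forall w, itlang f w <-> codelang tau theta w]].
Proof.
move=> Hf aper; have [N HN] := power_bound Hf aper.
have [R [phi [phi_onto phiP]]] := derived_words Hf HN.
have [k _ [theta [theta_inj theta_irred theta_phi]]] := phiP 0.
exists R, theta, (itmor f k [:: b]), (itmor f k [:: a]); split=> //.
  exact (two_letters Hf HN theta_irred theta_phi).
(* A word [phi(f^g(d))] contains every letter at least [Q.+3] times, once for each letter of
   [f^(g-1)(d)]. At most two copies are boundary letters, so the interior still contains every
   letter. *)
move=> Q; pose g := Q.+4.
pose K := \max_d size (mor phi (itmor f g [:: d])).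
pose mx := \max_r size (theta r).
(* The last summand makes the return words of level [k'] so long that every [tau r] has more than
   [K.*2] letters and thus contains some [phi(f^g(d))]. *)
have [k' nk' [theta' [theta'_inj theta'_irred theta'_phi]]] :=
  phiP (k + g.+2 + N * (K.*2.+1 * mx)).
have [q ek] : exists q, k' = k + q by exists (k' - k); lia.
subst k'.
have gq : g.+2 <= q by lia.
have q2 : 1 < q by lia.
have [tau theta_tau tau_phi] :=
  next_substitution Hf phi_onto theta_irred theta_phi theta'_irred theta'_phi.
have tau_long r : K.*2 < size (tau r).
  have [r0 gr _] := theta'_irred r.
  have := good_long HN r0 gr; have := size_itmor_gt Hf (k + q) (w :=
    [:: a]) isT.
  have : size (theta' r) <= size (tau r) * mx.
    by rewrite -theta_tau; apply: size_mor_le => t; exact: (leq_bigmax t).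
  move=> le1 lt1 lt2; rewrite ltnNge; apply/negP => le2.
  have : N * size (theta' r) <= N * (K.*2.+1 * mx).
    rewrite leq_mul2l; apply/orP; right; apply: leq_trans le1 _.
    by rewrite leq_mul2r ltnW ?orbT.
  move: nk' lt1 lt2; set X := N * (_ * _); set Y := N * _; clearbody X Y.
  by move: (size (itmor f (k + q) [:: a])) (g.+2) => Z G; clear; lia.
have tau_block r : exists d, infix (mor phi (itmor f g [:: d])) (tau r).
  have [c] := tau_phi r; have -> : q = g + (q - g) by lia.
  rewrite itmor_add itmor_mor mor_comp => infB.
  have [d|||d _ dP] := long_infix_block (K := K) _ _ _ infB.
  - exact: (leq_bigmax d).
  - exact: leq_ltn_trans (leq0n _) (tau_long r).
  - by rewrite mul2n ltnW.
  - by exists d.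
have tau_count c z : Q.+3 <= count_mem z (tau c).
  have [d /(leq_count_infix (pred1 z))] := tau_block c.
  apply: leq_trans; rewrite /g itmorS mor_comp.
  apply: leq_trans (leq_count_mor _ _); first exact/ltnW/(size_itmor_gt Hf).
  move=> y /=; rewrite -has_count has_pred1; have [e ze] := phi_onto z.
  by apply/mem_mor; exists e => //; apply: full_mem Hf _ _.
have tau_a r : infix (phi a) (tau r).
  have [d] := tau_block r; apply: infix_trans; rewrite -[X in infix X _]mor1.
  by apply/infix_mor/(@itmor_infix _ _ _ _ Hf 0).
have pa0 := phi_neq0 Hf theta_phi a; have pb0 := phi_neq0 Hf theta_phi b.
have [x [t et]] : exists x t, phi a = x :: t by case: (phi a) pa0 => // x t;
  exists x, t.
have [y [u eu]] : exists y u, phi b = rcons u y.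
  by case/lastP: (phi b) pb0 => // u y; exists y, u.
exists tau, x, y, (itmor f (k + q) [:: b]), (itmor f (k + q) [:: a]); split.
- move=> c.
  have := tau_first Hf theta_inj theta_irred theta_phi q2 theta'_irred
    theta_tau c (x := x).
  rewrite et /= eqxx prefix0s => /(_ isT)/prefixP[v ev].
  have := tau_last Hf theta_inj theta_irred theta_phi q2 theta'_irred
    theta_tau c (x := y).
  rewrite eu -cats1 suffix_suffix => /(_ isT)/suffixP[v' ev'].
  have cnt d := tau_count c d.
  case/lastP: v ev => [|v z] ev.
    by have := cnt x; rewrite ev /=; case: eqP.
  move: (ev'); rewrite ev cats1 cat1s -rcons_cons => /rcons_inj[_ ez].
  exists v; rewrite ez; split=> // d; have := cnt d.
  rewrite ev /= -cats1 count_cat /= -has_pred1 has_count.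
  by case: (_ == _); case: (_ == _) => /=; move: (count _ _); clear; lia.
- by move=> c z; apply: leq_trans (tau_count c z); lia.
- exact: (tau_inj theta'_inj theta_tau).
- by move=> r; rewrite theta_tau.
- exact (tau_codelang Hf phi_onto theta_inj theta_irred theta_phi q2 theta'_phi
    theta_tau tau_a).
Qed.

Lemma mor_flatten_nseq (S T : Type) (f : S -> seq T) n w :
  mor f (flatten (nseq n w)) = flatten (nseq n (mor f w)).
Proof. by elim: n => //= n IH; rewrite mor_cat IH. Qed.

(** * Rearranged substitutions and towers *)

Section Rearrangement.
Context {R : finType} {tau : R -> seq R} {x y d : R} {M : nat}.
Context (Htau : full tau x y).
Context (dx : d != x).
Context (M2 : 1 < M).

Definition marker := flatten (nseq M [:: x; d]).

Lemma size_marker : size marker = M.*2.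
Proof. by rewrite /marker; elim: M => //= n ->. Qed.

Lemma nth_marker i : i < M.*2 -> nth x marker i = if odd i then d else x.
Proof.
rewrite /marker; elim: M i => // n IH [|[|i]] //=.
by rewrite doubleS !ltnS negbK; apply: IH.
Qed.

(** The length of the first run of [d] labels the letter whose image this is. The next copies of [x]
    stand in one run, followed by at least two [d], so that no single [d] lies between two [x] even
    if [y = x]. The doubled [y] cannot be read as the beginning [x d] of a marker. *)
Definition tail_word i n1 n2 (o : seq R) :=
  nseq i.+1 d ++ nseq n1.+1 x ++ nseq n2.+2 d ++ o ++ [:: y; y].

Lemma tail_infix i n1 n2 o : x \notin o ->
  ~~ infix [:: x; d; x] (tail_word i n1 n2 o).
Proof.
have skip n w : infix [:: x; d; x] (nseq n d ++ w) = infix [:: x; d; x] w.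
  elim: n => [//|n IH]; rewrite [nseq n.+1 d]/= cat_cons infix_consl.
  by rewrite prefix_cons IH eq_sym (negPf dx).
move=> xo; rewrite /tail_word skip.
have -> : infix [:: x; d; x] (nseq n1.+1 x ++ nseq n2.+2 d ++ o ++ [:: y; y]) =
    infix [:: x; d; x] (nseq n2.+2 d ++ o ++ [:: y; y]).
  elim: n1 => [|n IH]; last first.
    rewrite -IH [nseq n.+2 x]/= cat_cons infix_consl !prefix_cons.
    by rewrite (negPf dx) andbF.
  rewrite [nseq 1 x]/= cat_cons infix_consl !prefix_cons [x == d]eq_sym.
  by rewrite (negPf dx) !andbF.
rewrite skip; elim: o xo => [|z o IH].
  by move=> _; apply/negP => /size_infix.
rewrite inE negb_or => /andP[xz xo].
by rewrite cat_cons infix_consl prefix_cons (negPf xz) /= IH.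
Qed.

(* An alternation x d x cannot occur in the tail, so an occurrence of the marker
   starting inside it would have to start in the last two letters; starting
   inside the marker, it would meet the initial d of the tail at an odd place. *)
Lemma marker_irred i n1 n2 o : x \notin o ->
  irred [::] marker (marker ++ tail_word i n1 n2 o).
Proof.
move=> xo; have M0 : 0 < M by lia.
split.
- by rewrite -size_eq0 size_cat size_marker; lia.
- by rewrite /good suffix0s andbT -catA prefix_prefix.
move=> s1 s2 e s10 s20 [_ /andP[/prefixP[u eu] _]].
have nthZ k : k < M.*2 -> nth x (s2 ++ marker) k = if odd k then d else x.
  by move=> kM; rewrite eu nth_cat size_marker kM nth_marker.
have xd : x <> d by move=> xd; move: dx; rewrite xd eqxx.
have nths2 k : k < size s2 -> nth x (s2 ++ marker) k =
    nth x (marker ++ tail_word i n1 n2 o) (size s1 + k).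
  by move=> ks; rewrite e !nth_cat ks ltnNge leq_addr /= addKn.
have szs : size s1 + size s2 = M.*2 + size (tail_word i n1 n2 o).
  by rewrite -size_cat -e size_cat size_marker.
have tl0 : 0 < size (tail_word i n1 n2 o) by [].
have s10' : 0 < size s1 by rewrite lt0n size_eq0.
have [le|lt] := leqP (size s1) M.*2.
  have h1 : nth x (s2 ++ marker) (M.*2 - size s1) = d.
    rewrite nths2; last by lia.
    by rewrite subnKC // nth_cat size_marker ltnn subnn.
  have odd1 : odd (M.*2 - size s1).
    move: h1; rewrite nthZ; last by lia.
    by case: odd => // /xd.
  have lt : size s1 < M.*2.
    by rewrite ltn_neqAle le andbT; apply: contraTneq odd1 => ->; rewrite subnn.
  have h0 : nth x (s2 ++ marker) 0 = d.
    rewrite nths2; last by lia.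
    rewrite addn0 nth_cat size_marker lt nth_marker //.
    by move: odd1; rewrite oddB // odd_double /= => ->.
  by move: h0; rewrite nthZ /=; [move/xd|lia].
have [s' [es1 et]] := cat_eq_le e (ltnW (eq_rect_r (fun n => n < size s1) lt
  size_marker)).
have s2t : suffix s2 (tail_word i n1 n2 o) by rewrite et suffix_suffix.
have n0 := nthZ 0; have n1' := nthZ 1; have n2' := nthZ 2.
case: s2 s20 {e nths2 szs eu nthZ} et s2t n0 n1' n2' => // z0 [|z1 [|z2 s2]] _
  et s2t n0 n1' n2'.
- move: n1'; rewrite /= -[X in _ = X]/d.
  have := @nth_marker 0; rewrite double_gt0 => /(_ M0) /= -> /(_ _) dx'.
  by apply/xd/dx'; lia.
- have ez0 : z0 = x by apply: n0; lia.
  have ez1 : z1 = d by apply: n1'; lia.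
  have : suffix [:: z0; z1] [:: y; y].
    apply: (@suffix_catr_size _ _ (nseq i.+1 d ++ nseq n1.+1 x ++ nseq n2.+2 d
      ++ o)) => //.
    by move: s2t; rewrite /tail_word !catA.
  by rewrite suffixE /= => /eqP[y0 y1]; apply: xd; rewrite -ez0 -ez1 -y0 -y1.
- have ez0 : z0 = x by apply: n0; lia.
  have ez1 : z1 = d by apply: n1'; lia.
  have ez2 : z2 = x by apply: n2'; lia.
  have /negP := tail_infix i n1 n2 xo; apply; apply: infix_suffix_trans s2t.
  by rewrite ez0 ez1 ez2; apply: (infix_infix [::] [:: x; d; x] s2).
Qed.

Context (Hcount : forall c z, M.*2 + #|R| + 7 <= count_mem z (tau c)).

(** The marker, the labelling run and the two final [y] take at most [M.*2 + #|R| + 2] letters, so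
    at least four copies of every letter remain for the other runs. *)
Lemma rearranged_word c : exists n1 n2 o, x \notin o /\
  perm_eq (tau c) (marker ++ tail_word (index c (enum R)) n1 n2 o).
Proof.
set i := index c (enum R).
have iR : i < #|R| by rewrite cardE index_mem mem_enum.
pose u := marker ++ nseq i.+1 d ++ [:: y; y].
have szu : size u = M.*2 + (i.+1 + 2) by rewrite !size_cat size_marker
  size_nseq.
have countu z : count_mem z u + 4 <= count_mem z (tau c).
  apply: leq_trans (Hcount c z); have := count_size (pred1 z) u; rewrite szu.
  by lia.
have [w /perm_to_subseq[v ev] pu] : exists2 w, subseq w (tau c) & perm_eq u w.
  by apply/count_subseqP => z; have := countu z; lia.
have {}ev : perm_eq (tau c) (u ++ v).
  by apply: (perm_trans ev); rewrite perm_cat2r perm_sym.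
have countv z : 4 <= count_mem z v.
  have := countu z; have /permP/(_ (pred1 z)) := ev; rewrite count_cat => ->.
  by lia.
have nx := countv x; have nd := countv d.
pose o := [seq z <- [seq z <- v | z != x] | z != d].
exists (count_mem x v).-1, (count_mem d v).-2, o; split.
  by rewrite !mem_filter eqxx andbF.
apply: (perm_trans ev); rewrite /u /tail_word.
have -> : (count_mem x v).-1.+1 = count_mem x v by lia.
have -> : (count_mem d v).-2.+2 = count_mem d v by lia.
rewrite -!catA perm_cat2l perm_cat2l perm_catC !catA perm_cat2r.
have ef z w' : [seq z' <- w' | z' == z] = nseq (count_mem z w') z.
  by rewrite -size_filter; apply/all_pred1P; rewrite filter_all.
have -> : nseq (count_mem d v) d = [seq z <- [seq z <- v | z != x] | z == d].
  rewrite ef count_filter; congr nseq; apply: eq_count => z /=.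
  by case: eqP => // ->; rewrite dx.
rewrite -ef -catA perm_sym.
apply: (@perm_trans _ ([seq z <- v | z == x] ++ [seq z <- v | z != x])).
  by rewrite perm_cat2l; apply/permEl/perm_filterC.
by apply/permEl/perm_filterC.
Qed.

Lemma rearrangement : exists tau' : R -> seq R,
  [/\ forall c, exists s s', [/\ tau c = x :: rcons s y,
    tau' c = x :: rcons s' y
                                & perm_eq s s'],
      injective tau', forall c, irred [::] marker (tau' c) &
      forall c, infix marker (tau' c)].
Proof.
have /fin_all_exists[g gP] : forall c, exists v : seq R,
    exists n1 n2 o, [/\ x \notin o, perm_eq (tau c) v &
      v = marker ++ tail_word (index c (enum R)) n1 n2 o].
  move=> c; have [n1 [n2 [o [xo p]]]] := rearranged_word c.
  by exists (marker ++ tail_word (index c (enum R)) n1 n2 o), n1, n2, o.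
exists g; split.
- move=> c; have [n1 [n2 [o [xo p e]]]] := gP c.
  have [s [es _]] := Htau c.
  have [s' es'] : exists s', g c = x :: rcons s' y.
    have [m em] : exists m, marker = x :: m.
      by rewrite /marker; move: M2; case: M => // k _; eexists.
    rewrite e /tail_word em.
    exists (m ++ nseq (index c (enum R)).+1 d ++ nseq n1.+1 x ++ nseq n2.+2 d
      ++ o ++ [:: y]).
    by rewrite -cats1 -!catA.
  exists s, s'; split=> //.
  move: p; rewrite es es' perm_cons -!cats1 => /permPr p.
  by rewrite -(perm_cat2r [:: y]) -p perm_refl.
- move=> c c' e; have [n1 [n2 [o [_ _ ec]]]] := gP c.
  have [m1 [m2 [o' [_ _ ec']]]] := gP c'.
  move: e; rewrite ec ec' => /eqP; rewrite eqseq_cat // eqxx /= => /eqP.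
  (* The position of the first letter other than [d] reads the label off the tail. *)
  have fnd i n1' n2' o'' : find (predC1 d) (tail_word i n1' n2' o'') = i.+1.
    have hn : has (predC1 d) (nseq i.+1 d) = false.
      by rewrite has_nseq /= eqxx.
    rewrite /tail_word find_cat hn size_nseq /= [x == d]eq_sym dx.
    by rewrite addn0.
  move/(congr1 (find (predC1 d))); rewrite !fnd => -[].
  by move=> ei; rewrite -(nth_index c (mem_enum R c)) ei nth_index // mem_enum.
- by move=> c; have [n1 [n2 [o [xo _ ->]]]] := gP c; apply: marker_irred.
- by move=> c; have [n1 [n2 [o [xo _ ->]]]] := gP c;
  apply/prefixW/prefix_prefix.
Qed.

End Rearrangement.

Section Pieces.
Context {T : eqType}.

(** Any division into [h] nonempty pieces would do; here all but the last are single letters. *)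
Fixpoint pieces h (w : seq T) : seq (seq T) :=
  if h is h'.+1 then
    if h' is _.+1 then take 1 w :: pieces h' (behead w) else [:: w]
  else [::].

Lemma size_pieces h w : size (pieces h w) = h.
Proof. by elim: h w => //= -[//|h] IH w; rewrite /= IH. Qed.

Lemma flatten_pieces h w : 0 < h -> flatten (pieces h w) = w.
Proof.
elim: h w => //= -[_|h IH] w _; first by rewrite /= cats0.
by case: w => [|z w]; [rewrite [flatten _]IH|rewrite [flatten _]/= IH // take0].
Qed.

Lemma pieces_neq0 h w p : h <= size w -> p \in pieces h w -> p != [::].
Proof.
elim: h w => // -[_|h IH] w hw.
  by rewrite inE => /eqP->; rewrite -size_eq0; case: w hw.
case: w hw => // z w hw; rewrite inE => /orP[/eqP->//|]; exact: IH.
Qed.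

End Pieces.

Section Tower.
Context {R : finType} {tau : R -> seq R} {x y : R} {h : R -> nat}.
Context (Htau : full tau x y).
Context (h0 : forall r, 0 < h r).
Context (htau : forall r, h r <= size (tau r)).

Definition tower := {r : R & 'I_(h r)}.

Definition floors (r : R) : seq tower :=
  [seq Tagged (fun r => 'I_(h r)) j | j <- enum 'I_(h r)].

(** The floors of a column share the word that [floors] assigns to [tau r], so that [floors]
    intertwines [tau] with this substitution. If the column is no higher than [tau r] is long, no
    floor goes empty. *)
Definition tower_subst (b : tower) : seq tower :=
  mor floors (nth [::] (pieces (h (tag b)) (tau (tag b))) (tagged b)).

Lemma size_floors r : size (floors r) = h r.
Proof. by rewrite size_map size_enum_ord. Qed.

Lemma floors_neq0 r : floors r != [::].
Proof. by rewrite -size_eq0 size_floors -lt0n. Qed.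

Lemma mem_floors (b : tower) : b \in floors (tag b).
Proof. by case: b => r j; apply/mapP; exists j => //; rewrite mem_enum. Qed.

Lemma mor_tower_floors r : mor tower_subst (floors r) = mor floors (tau r).
Proof.
rewrite -[X in _ = mor _ X](flatten_pieces (tau r) (h0 r)) /mor map_flatten.
transitivity (flatten [seq mor floors p | p <- pieces (h r) (tau r)]);
  last first.
  by elim: (pieces _ _) => //= p s IH; rewrite flatten_cat -IH.
congr flatten; rewrite -map_comp.
rewrite -[X in _ = map _ X](mkseq_nth [::]) size_pieces /mkseq.
by rewrite -val_enum_ord; elim: (enum 'I_(h r)) => //= j s ->.
Qed.

Lemma itmor_tower_floors n w : itmor tower_subst n (mor floors w) = mor floors
  (itmor tau n w).
Proof.
elim: n => // n IH; rewrite !itmorS IH !mor_comp; apply: eq_mor => r /=.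
exact: mor_tower_floors.
Qed.

Lemma tower_itmor n b : exists2 p, p != [::] &
  itmor tower_subst n.+1 [:: b] = mor floors (itmor tau n p).
Proof.
exists (nth [::] (pieces (h (tag b)) (tau (tag b))) (tagged b)); last first.
  by rewrite itmorSr mor1 itmor_tower_floors.
by apply: pieces_neq0 (htau (tag b)) _; rewrite mem_nth // size_pieces.
Qed.

Lemma tower_subst_neq0 b : tower_subst b != [::].
Proof.
have [p p0] := tower_itmor 0 b; rewrite /itmor /= mor1 => ->.
case: p p0 => // r p _; rewrite mor_cons.
by have := floors_neq0 r; case: floors.
Qed.

(** One application leads to whole columns, the second passes through [tau], whose images have
    common boundary letters. *)
Lemma tower_boundary : exists a b, forall c,
  prefix [:: a] (itmor tower_subst 2 [:: c]) /\ suffix [:: b] (itmor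
    tower_subst 2 [:: c]).
Proof.
have [a [s ea]] : exists a s, floors x = a :: s.
  by case: (floors x) (floors_neq0 x) => // a s; exists a, s.
have [b [t eb]] : exists b t, floors y = rcons t b.
  by case/lastP: (floors y) (floors_neq0 y) => // t b; exists b, t.
exists a, b => c; have [p p0 ->] := tower_itmor 1 c.
have /prefixP[u eu] := full_prefix Htau p0.
have /suffixP[v ev] := full_suffix Htau p0.
rewrite itmorS; split.
  by rewrite eu mor_cat mor1 ea /= eqxx prefix0s.
by rewrite ev mor_cat mor1 eb -cats1 catA suffix_suffix.
Qed.

Lemma tower_mem b c : c \in itmor tower_subst 2 [:: b].
Proof.
have [p p0 ->] := tower_itmor 1 b; apply/mem_mor; exists (tag c).
  by apply: (itmor_mem Htau).
exact: mem_floors.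
Qed.

Lemma tower_codelang w : itlang tower_subst w <-> codelang tau floors w.
Proof.
split.
- case=> n [b wb]; exists n, (tag b).
  have := infix_mor_mem (fun b => [:: b]) (mem_floors b); rewrite mor_id.
  move/(infix_itmor tower_subst n); rewrite -[floors _]mor1 itmor_tower_floors.
  exact: infix_trans.
- case=> n [r wr]; pose b : tower := Tagged (fun r => 'I_(h r)) (Ordinal (h0
  r)).
  exists n.+2, b; have [p p0 ->] := tower_itmor n.+1 b.
  by apply: infix_trans wr _; apply/infix_mor/(itmor_infix Htau).
Qed.

Lemma floors_inj : injective floors.
Proof.
move=> r r' e; have := mem_floors (Tagged (fun r => 'I_(h r)) (Ordinal (h0 r))).
by rewrite /= e => /mapP[j _ []].
Qed.

(* Ground floors carry the index 0, so a symbol alone marks the cuts. *)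
Lemma floors_irred r :
  irred [::] [:: true] (mor (fun b : tower => [:: (tagged b : nat) == 0])
    (floors r)).
Proof.
have -> : mor (fun b : tower => [:: (tagged b : nat) == 0]) (floors r) =
    true :: nseq (h r).-1 false.
  transitivity [seq k == 0 | k <- iota 0 (h r)].
    rewrite -val_enum_ord -map_comp /floors.
    by elim: (enum _) => //= j s IH; rewrite mor_cons IH.
  case: (h r) (h0 r) => // n _ /=; congr cons.
  have E k : [seq j == 0 | j <- iota k.+1 n] = nseq n false.
    by elim: n k => //= n IH k; rewrite IH.
  exact: E.
split=> //; first by rewrite /good suffix0s cat_cons prefix_cons prefix0s.
move=> [//|c s1] [//|d s2] [_ e] _ _ [_ /andP[+ _]].
rewrite cat_cons prefix_cons => /andP[/eqP dE _].
have : true \in nseq (h r).-1 false by rewrite e -dE mem_cat mem_head orbT.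
by rewrite mem_nseq andbF.
Qed.

End Tower.

(** * Recognizability of bi-infinite words *)

Section Windows.
Context {A : Type}.
Implicit Types (x y : int -> A) (t : int) (w : seq A).
Local Open Scope ring_scope.

Definition window x t n := mkseq (fun j => x (t + j%:Z)) n.

Definition occurs x t w := window x t (size w) = w.

Definition shiftby (d : int) x : int -> A := fun i => x (i + d).

Lemma size_window x t n : size (window x t n) = n.
Proof. exact: size_mkseq. Qed.

Lemma window_cat x t m n :
  window x t (m + n) = window x t m ++ window x (t + m%:Z) n.
Proof.
rewrite /window /mkseq iotaD map_cat; congr cat.
rewrite -[(0 + m)%N]addn0 iotaDl -map_comp; apply: eq_map => j /=.
by congr (x _); lia.
Qed.

Lemma occurs_window x t n : occurs x t (window x t n).
Proof. by rewrite /occurs size_window. Qed.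

Lemma occurs_cat x t u v :
  occurs x t (u ++ v) <-> occurs x t u /\ occurs x (t + (size u)%:Z) v.
Proof.
rewrite /occurs size_cat window_cat; split=> [e|[-> ->]] //.
have := congr1 (take (size u)) e; have := congr1 (drop (size u)) e.
by rewrite !take_size_cat ?drop_size_cat ?size_window.
Qed.

Lemma occurs_sub x t u v w :
  occurs x t (u ++ v ++ w) -> occurs x (t + (size u)%:Z) v.
Proof. by move/occurs_cat=> [_ /occurs_cat[]]. Qed.

Lemma occurs_nth a0 x t w i : occurs x t w -> (i < size w)%N ->
  x (t + i%:Z) = nth a0 w i.
Proof. by move=> <-; rewrite size_window => iw; rewrite nth_mkseq. Qed.

Lemma occP a0 x t w :
  (forall i, (i < size w)%N -> x (t + i%:Z) = nth a0 w i) -> occurs x t w.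
Proof.
move=> xw; apply: (@eq_from_nth _ a0); rewrite size_window // => i iw.
by rewrite nth_mkseq // xw.
Qed.

Lemma window_shiftby d x t n : window (shiftby d x) t n = window x (t + d) n.
Proof. by apply: eq_mkseq => j; rewrite /shiftby addrAC. Qed.

Lemma occurs_shiftby d x t w : occurs (shiftby d x) t w <-> occurs x (t + d) w.
Proof. by rewrite /occurs window_shiftby. Qed.

Lemma occurs_eq x y : (forall N, exists t w,
    [/\ t <= - N%:Z, N%:Z <= t + (size w)%:Z, occurs x t w & occurs y t w]) ->
  x = y.
Proof.
move=> H; apply: funext => i.
have [t [w [tN Nt xw yw]]] := H (absz i).+1.
have {xw yw} := etrans xw (esym yw).
move/(congr1 (fun s => nth (x i) s (absz (i - t)%R))).
rewrite !nth_mkseq; [|lia..].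
by have -> : t + (absz (i - t)%R)%:Z = i by lia.
Qed.

Lemma window_inside x t w s n : occurs x t w -> t <= s ->
  s + n%:Z <= t + (size w)%:Z -> exists u v, w = u ++ window x s n ++ v /\ t +
    (size u)%:Z = s.
Proof.
move=> xw ts mor; set m := absz (s - t).
have em : t + m%:Z = s by lia.
exists (window x t m), (window x (s + n%:Z) (size w - (m + n))).
rewrite size_window; split=> //.
have e : size w = (m + (n + (size w - (m + n))))%N by lia.
by rewrite -{1}xw {1}e !window_cat em.
Qed.

End Windows.

Section Dec.
Context {R S : Type} {f : R -> seq S}.
Context (f0 : forall r, 0 < size (f r)).
Local Open Scope ring_scope.

Definition decomp (z : int -> R) (c : int -> int) (x : int -> S) :=
  forall i, c (i + 1) = c i + (size (f (z i)))%:Z /\ occurs x (c i) (f (z i)).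

Context {z : int -> R} {c : int -> int} {x : int -> S}.
Context (zcx : decomp z c x).

Lemma decomp_window i n : c (i + n%:Z) = c i + (size (mor f (window z i n)))%:Z
  /\
  occurs x (c i) (mor f (window z i n)).
Proof.
elim: n => [|n [IHc IHo]]; first by rewrite !addr0.
rewrite -addn1 window_cat mor_cat size_cat [window z _ 1]/= mor1 addr0 PoszD
  addrA.
have [-> o] := zcx (i + n%:Z); rewrite IHc; split; first by lia.
by apply/occurs_cat; rewrite -IHc.
Qed.

Lemma decomp_lt i j : i < j -> c i < c j.
Proof.
move=> ij; have -> : j = i + (absz (j - i))%:Z by lia.
have [-> _] := decomp_window i (absz (j - i)).
have := size_mor_ge (window z i (absz (j - i))) f0; rewrite muln1 size_window.
by lia.
Qed.

Lemma decomp_lt_inv i j : c i < c j -> i < j.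
Proof.
move=> cij; rewrite ltNge; apply/negP; rewrite le_eqVlt => /orP[/eqP
  e|/decomp_lt].
  by move: cij; rewrite e ltxx.
by lia.
Qed.

Lemma decomp_find t : exists i, c i <= t < c (i + 1).
Proof.
have lo n : c (- n%:Z) <= c 0 - n%:Z.
  have [e _] := decomp_window (- n%:Z) n.
  have := size_mor_ge (window z (- n%:Z) n) f0; rewrite muln1 size_window.
  by move: e; rewrite addNr; move: (c (- n%:Z)) (c 0) (size _) => u v k; lia.
have hi n : c 0 + n%:Z <= c n%:Z.
  have [e _] := decomp_window 0 n.
  have := size_mor_ge (window z 0 n) f0; rewrite muln1 size_window.
  by move: e; rewrite add0r; lia.
have [m em] : exists m, m = absz (c 0 - t) by eexists.
have [i0 ei0] : exists i0, i0 = - m%:Z by eexists.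
have ci0 : c i0 <= t by have := lo m; rewrite -ei0; lia.
have ex : exists n : nat, t < c (i0 + n%:Z + 1).
  exists (m + m)%N; have -> : i0 + (m + m)%N%:Z + 1 = m.+1%:Z by lia.
  by have := hi m.+1; lia.
have [n nP nmin] := ex_minnP ex; exists (i0 + n%:Z); rewrite nP andbT.
case: n nP nmin => [|n] nP nmin; first by rewrite addr0.
rewrite leNgt; apply/negP => lt; have := nmin n.
have -> : i0 + n%:Z + 1 = i0 + n.+1%:Z by lia.
by rewrite lt ltnn => /(_ isT).
Qed.

End Dec.

Section Recognition.
Context {R : Type} {S A : eqType} {f : R -> seq S} {g : S ->
  seq A} {ul ur : seq A}.
Context (f_irred : forall r, irred ul ur (mor g (f r))).
Context (g0 : forall s, 0 < size (g s)).
Local Open Scope ring_scope.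

Lemma irred_size r : (0 < size (f r))%N.
Proof. by have [+ _ _] := f_irred r; case: (f r). Qed.

Let good_f w : good ul ur (mor g (mor f w)).
Proof.
rewrite mor_comp; apply: good_flatten => p.
elim: w => // r w IH; rewrite inE => /orP[/eqP->|/IH//].
by have [] := f_irred r.
Qed.

Let size_gf w : (size w <= size (mor g (mor f w)))%N.
Proof.
have := size_mor_ge w irred_size; have := size_mor_ge (mor f w) g0.
by rewrite !muln1 => le1 le2; apply: leq_trans le2 le1.
Qed.

(* A property of the shifted point alone: it does not refer to the
   decomposition, hence two decompositions of [x] have the same cuts. *)
Definition marked (x : int -> S) t :=
  (exists n, suffix ul (mor g (window x (t - n%:Z) n))) /\
  (exists n, prefix ur (mor g (window x t n))).

Section Marked.
Context {z : int -> R} {c : int -> int} {x : int -> S}.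
Context (zcx : decomp (f := f) z c x).

Let right_good i : prefix ur (mor g (mor f (window z i (size ur)))).
Proof.
have /andP[p _] := good_f (window z i (size ur)).
apply: prefix_catl_size p _; have := size_gf (window z i (size ur)).
by rewrite size_window.
Qed.

Let left_good i : suffix ul (mor g (mor f (window z (i - (size ul)%:Z) (size
  ul)))).
Proof.
have /andP[_ p] := good_f (window z (i - (size ul)%:Z) (size ul)).
apply: suffix_catr_size p _; have := size_gf (window z (i - (size ul)%:Z) (size
  ul)).
by rewrite size_window.
Qed.

Lemma cut_marked i : marked x (c i).
Proof.
split.
- set w := window z (i - (size ul)%:Z) (size ul).
  exists (size (mor f w)).
  have [ci o] := decomp_window zcx (i - (size ul)%:Z) (size ul).
  rewrite -/w subrK in ci o; rewrite ci addrK o; exact: left_good.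
- set w := window z i (size ur); exists (size (mor f w)).
  have [_ o] := decomp_window zcx i (size ur).
  rewrite -/w in o; rewrite o; exact: right_good.
Qed.

(** A marked position strictly inside a block would cut it into two good words. The windows are
    lengthened to whole blocks on either side, where goodness of the neighbouring blocks is
    available. *)
Lemma marked_cut t : marked x t -> exists i, c i = t.
Proof.
case=> -[n nP] [m mP]; have [i /andP[itmor ti]] := decomp_find irred_size zcx t.
have [e|it'] := eqVneq (c i) t; first by exists i.
have {}itmor : c i < t by rewrite lt_neqAle it' itmor.
have [ci oi] := zcx i.
set k := absz (t - c i); pose s1 := take k (f (z i));
  pose s2 := drop k (f (z i)).
have kf : (0 < k < size (f (z i)))%N by move: ti; rewrite ci /k; lia.
have ef : f (z i) = s1 ++ s2 by rewrite cat_take_drop.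
have ss1 : size s1 = k by rewrite size_takel //; lia.
have ss2 : size s2 = (size (f (z i)) - k)%N by rewrite size_drop.
have tk : t = c i + k%:Z by rewrite /k; lia.
have [_ gf irr] := f_irred (z i).
case: (irr (mor g s1) (mor g s2)); first by rewrite -mor_cat -ef.
- have := size_mor_ge s1 g0; rewrite muln1 -size_eq0; lia.
- have := size_mor_ge s2 g0; rewrite muln1 -size_eq0; lia.
apply: good_split; first by rewrite -mor_cat -ef.
- set w := window z (i + 1) (size ur + m).
  have [_ o] := decomp_window zcx (i + 1) (size ur + m); rewrite -/w in o.
  have o2 : occurs x t (s2 ++ mor f w).
    apply/occurs_cat; split.
      by move: oi; rewrite ef => /occurs_cat[_]; rewrite ss1 -tk.
    by have -> : t + (size s2)%:Z = c (i + 1) by rewrite ci ss2 tk; lia.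
  have pw : prefix ur (mor g s2 ++ mor g (mor f w)).
    rewrite -mor_cat -o2; apply: prefix_trans mP _; apply: prefix_mor.
    have -> : size (s2 ++ mor f w) = (m + (size (s2 ++ mor f w) - m))%N.
      have := size_mor_ge w irred_size; rewrite muln1 size_window size_cat; lia.
    by rewrite window_cat prefix_prefix.
  have /prefixP[v ev] : prefix ur (mor g (mor f w)).
    have := right_good (i + 1); rewrite /w window_cat !mor_cat =>
      /prefix_trans; apply.
    exact: prefix_prefix.
  by move: pw; rewrite ev catA => /prefix_catl_size; apply;
    rewrite size_cat leq_addl.
- set w := window z (i - (size ul + n)%N%:Z) (size ul + n).
  have [ci' o] := decomp_window zcx (i - (size ul + n)%N%:Z) (size ul + n).
  rewrite -/w subrK in ci' o.
  set s := c (i - _) in ci' o.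
  have o2 : occurs x s (mor f w ++ s1).
    apply/occurs_cat; split=> //; rewrite -ci'.
    by move: oi; rewrite ef => /occurs_cat[].
  have pw : suffix ul (mor g (mor f w) ++ mor g s1).
    rewrite -mor_cat -o2; apply: suffix_trans nP _; apply: suffix_mor.
    have e : size (mor f w ++ s1) = (size (mor f w ++ s1) - n + n)%N.
      have := size_mor_ge w irred_size; rewrite muln1 size_window size_cat; lia.
    rewrite e window_cat; set u := window x _ n; set u' := window x _ n.
    suff -> : u' = u by apply: suffix_suffix.
    by congr window; move: e; rewrite size_cat ss1 tk ci'; lia.
  have /suffixP[v ev] : suffix ul (mor g (mor f w)).
    have := left_good i; rewrite /w addnC window_cat !mor_cat.
    have -> : i - (n + size ul)%N%:Z + n%:Z = i - (size ul)%:Z by lia.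
    by move=> /suffix_trans; apply; apply: suffix_suffix.
  by move: pw; rewrite ev -catA => /suffix_catr_size; apply;
    rewrite size_cat leq_addr.
Qed.

End Marked.

Context (f_inj : injective f).

(** Equal cuts, enumerated from the block that contains the origin, give [c = c'], and injectivity
    of [f] gives the letters. The coding [g] is for patterns visible only in an image: under [theta]
    for [tau], under the ground floor symbol for towers. *)
Lemma irred_recognizable z z' c c' x : decomp (f := f) z c x -> decomp (f :=
  f) z' c' x ->
  c 0 <= 0 < c 1 -> c' 0 <= 0 < c' 1 -> c 0 = c' 0 /\ z = z'.
Proof.
move=> d d' /andP[c_le0 c_gt0] /andP[c_le0' c_gt0'].
have next (z1 z2 : int -> R) (c1 c2 : int -> int) : decomp (f := f) z1 c1 x ->
    decomp (f := f) z2 c2 x -> forall i, c1 i = c2 i ->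
      c1 (i + 1) <= c2 (i + 1).
  move=> d1 d2 i e; have [j ej] := marked_cut d1 (cut_marked d2 (i + 1)).
  have : c1 i < c1 j by rewrite ej e; apply: (decomp_lt irred_size d2); lia.
  move/(decomp_lt_inv irred_size d1); rewrite -ej -lezD1 le_eqVlt =>
    /orP[/eqP->//|].
  by move/(decomp_lt irred_size d1)/ltW.
have prev (z1 z2 : int -> R) (c1 c2 : int -> int) : decomp (f := f) z1 c1 x ->
    decomp (f := f) z2 c2 x -> forall i, c1 (i + 1) = c2 (i + 1) ->
      c1 i <= c2 i.
  move=> d1 d2 i e; have [j ej] := marked_cut d2 (cut_marked d1 i).
  have : c2 j < c2 (i + 1) by rewrite ej -e; apply: (decomp_lt irred_size d1);
    lia.
  move/(decomp_lt_inv irred_size d2); rewrite ltzD1 -ej le_eqVlt =>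
    /orP[/eqP->//|].
  by move/(decomp_lt irred_size d2)/ltW.
have zero (z1 z2 : int -> R) (c1 c2 : int -> int) : decomp (f := f) z1 c1 x ->
    decomp (f := f) z2 c2 x -> c1 0 <= 0 -> 0 < c2 1 -> c1 0 <= c2 0.
  move=> d1 d2 le0 lt0; have [j ej] := marked_cut d2 (cut_marked d1 0).
  have : c2 j < c2 1 by rewrite ej; apply: le_lt_trans lt0.
  move/(decomp_lt_inv irred_size d2) => j1; have : j <= 0 by lia.
  by rewrite -ej le_eqVlt => /orP[/eqP->//|/(decomp_lt irred_size d2)/ltW].
have e0 : c 0 = c' 0.
  apply/eqP; rewrite eq_le; apply/andP; split;
    [apply: (zero _ _ _ _ d d')|apply: (zero _ _ _ _ d' d)] => //.
split=> //.
have cc : c =1 c'.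
  have up n : c n%:Z = c' n%:Z.
    elim: n => // n IH; rewrite -addn1 PoszD; apply/eqP; rewrite eq_le.
    by rewrite (next _ _ _ _ d d') // (next _ _ _ _ d' d).
  have down n : c (- n%:Z) = c' (- n%:Z).
    elim: n => // n IH.
    have e : - n.+1%:Z + 1 = - n%:Z by lia.
    apply/eqP; rewrite eq_le.
    by rewrite (prev _ _ _ _ d d') ?(prev _ _ _ _ d' d) ?e.
  by case=> n; [apply: up|rewrite NegzE; apply: down].
apply: funext => i; apply: f_inj.
have [n1 o1] := d i; have [n2 o2] := d' i; rewrite -!cc n1 in n2 o2.
have es : size (f (z i)) = size (f (z' i)) by lia.
by rewrite -o1 es o2.
Qed.

End Recognition.

(** * Bratteli paths *)

Section Glue.
Context {A : eqType} (a0 : A) (l r : nat -> seq A).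
Local Open Scope ring_scope.

(** Meant for nested halves whose [i]-th term has more than [i] letters: then any later half gives
    the same letter at a coordinate, and the default [a0] is never reached. *)
Definition glue_words (t : int) : A :=
  match t with
  | Posz i => nth a0 (r i) i
  | Negz i => nth a0 (rev (l i)) i
  end.

Context (l_mono : forall n, suffix (l n) (l n.+1)).
Context (r_mono : forall n, prefix (r n) (r n.+1)).
Context (l_long : forall n, (n < size (l n))%N).
Context (r_long : forall n, (n < size (r n))%N).

Lemma glue_occurs n : occurs glue_words (- (size (l n))%:Z) (l n ++ r n).
Proof.
have nth_prefix (u v : seq A) i : prefix u v -> (i < size u)%N ->
    nth a0 u i = nth a0 v i.
  by case/prefixP=> w -> iu; rewrite nth_cat iu.
have nth_chain (w : nat -> seq A) : (forall n, prefix (w n) (w n.+1)) ->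
    forall m n i, (i < size (w m))%N -> (i < size (w n))%N ->
    nth a0 (w m) i = nth a0 (w n) i.
  move=> wm; have le m k : prefix (w m) (w (m + k)%N).
    by elim: k => [|k IH]; rewrite ?addn0 ?prefix_refl // addnS (prefix_trans
      IH).
  move=> m n' i im iN; case: (leqP m n') => mn.
    by rewrite -(subnKC mn); apply: nth_prefix.
  by rewrite -(subnKC (ltnW mn)); apply/esym/nth_prefix.
have l_chain := nth_chain (fun n => rev (l n)) (fun n => etrans (prefix_rev _
  _) (l_mono n)).
apply: (@occP _ a0) => i; rewrite size_cat nth_cat => ilr.
have [il|li] := ltnP i (size (l n)).
  pose k := (size (l n) - i.+1)%N.
  have -> : - (size (l n))%:Z + i%:Z = Negz k by rewrite NegzE /k; lia.
  rewrite /= (l_chain k n) ?size_rev //; last by rewrite /k; lia.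
  by rewrite nth_rev /k; [congr nth; lia|lia].
have -> : - (size (l n))%:Z + i%:Z = Posz (i - size (l n)) by lia.
by rewrite /=; apply: nth_chain => //; lia.
Qed.

End Glue.

Section Paths.
Context {R : eqType} (tau : R -> seq R) (al be : R).
Context (Htau : full tau al be).
Implicit Types e : nat -> R * nat.

(* [e n.+1 = (c, k)] is the edge that joins [c] at level [n.+1] to the letter at
   position [k] of [tau c]; [(e 0).2] is a position in the word coded by
   [(e 0).1]. *)
Definition path_at e :=
  forall n, (e n.+1).2 < size (tau (e n.+1).1) /\
            nth (e n).1 (tau (e n.+1).1) (e n.+1).2 = (e n).1.

Fixpoint left_word e n := if n is n'.+1
  then itmor tau n' (take (e n).2 (tau (e n).1)) ++ left_word e n' else [::].

Fixpoint right_word e n := if n is n'.+1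
  then right_word e n' ++ itmor tau n' (drop (e n).2.+1 (tau (e n).1)) else
    [::].

Lemma path_split e n : path_at e -> tau (e n.+1).1 =
  take (e n.+1).2 (tau (e n.+1).1) ++
  (e n).1 :: drop (e n.+1).2.+1 (tau (e n.+1).1).
Proof.
move=> /(_ n)[lt e_n]; rewrite -[LHS](cat_take_drop (e n.+1).2); congr cat.
by rewrite (drop_nth (e n).1) // e_n.
Qed.

Lemma itmor_path e n : path_at e ->
  itmor tau n [:: (e n).1] = left_word e n ++ (e 0).1 :: right_word e n.
Proof.
move=> pe; elim: n => // n IH.
rewrite itmorSr mor1 (path_split n pe) -cat1s !itmor_cat IH /=.
by rewrite -!catA.
Qed.

Definition path_tail e n := e n.+1.

Lemma path_at_tail e : path_at e -> path_at (path_tail e).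
Proof. by move=> pe n; apply: pe. Qed.

Lemma left_word_tail e n :
  left_word e n.+1 = mor tau (left_word (path_tail e) n) ++ take (e 1).2 (tau
    (e 1).1).
Proof.
elim: n => [|n IH]; first by rewrite /= cats0.
by rewrite [left_word e n.+2]/= -/(left_word e n.+1) IH [left_word (path_tail
  e) n.+1]/= mor_cat catA.
Qed.

Lemma eq_left_word e e' n k : (forall m, n < m -> e m = e' m) ->
  exists w, left_word e (n + k) = w ++ left_word e n /\ left_word e' (n + k) =
    w ++ left_word e' n.
Proof.
move=> ee; elim: k => [|k [w [IH IH']]]; first by exists [::]; rewrite !addn0.
rewrite addnS /= IH IH' ee ?ltnS ?leq_addr //.
by eexists; rewrite !catA; split.
Qed.

Lemma itmor_suffix1 n w : w != [::] -> suffix (itmor tau n [:: be]) (itmor tau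
  n.+1 w).
Proof. by move=> w0; apply: (itmor_suffix Htau). Qed.

Lemma itmor_prefix1 n w : w != [::] -> prefix (itmor tau n [:: al]) (itmor tau
  n.+1 w).
Proof. by move=> w0; apply: (itmor_prefix Htau). Qed.

(** The letter [c] is interior in [tau al], so its block has neighbours on both sides there, which
    end and begin with the boundary blocks. This keeps the lengthened halves of a point inside the
    language. *)
Lemma extended_infix n c :
  infix (itmor tau n [:: be] ++ itmor tau n.+1 [:: c] ++ itmor tau n [:: al])
        (itmor tau n.+2 [:: al]).
Proof.
have [s [es sP]] := Htau al; have /splitPr cs := sP c.
case: s / cs es {sP} => s1 s2 es.
have -> : itmor tau n.+2 [:: al] =
    itmor tau n.+1 (al :: s1) ++ itmor tau n.+1 [:: c] ++ itmor tau n.+1 (rcons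
      s2 be).
  by rewrite -!itmor_cat itmorSr mor1 es /= rcons_cat.
have /suffixP[u ->] : suffix (itmor tau n [:: be]) (itmor tau n.+1 (al :: s1)).
  exact: itmor_suffix1.
have /prefixP[v ->] : prefix (itmor tau n [:: al]) (itmor tau n.+1 (rcons s2
  be)).
  by apply: itmor_prefix1; case: s2 {es}.
by apply/infixP; exists u, v; rewrite -!catA.
Qed.

Section Points.
Context {A : eqType} (theta : R -> seq A) (a0 : A).
Context (theta0 : forall r, 0 < size (theta r)).

Definition edge_path e := (e 0).2 < size (theta (e 0).1) /\ path_at e.

(** The distance from the start of the level [n] block around the origin to the origin. *)
Definition pointer e n := size (mor theta (left_word e n)) + (e 0).2.

(* The blocks [tau^n be] and [tau^n al] always surround a level [n.+1] block;
   adding them makes both halves grow even along an extremal path. *)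
Definition left_half e n := mor theta (itmor tau n [:: be] ++ left_word e n.+1)
  ++
  take (e 0).2 (theta (e 0).1).

Definition right_half e n := drop (e 0).2 (theta (e 0).1) ++
  mor theta (right_word e n.+1 ++ itmor tau n [:: al]).

Definition path_point e := glue_words a0 (left_half e) (right_half e).

Lemma left_half_right_half e n : edge_path e ->
  left_half e n ++ right_half e n =
  mor theta (itmor tau n [:: be] ++ itmor tau n.+1 [:: (e n.+1).1] ++ itmor tau
    n [:: al]).
Proof.
case=> _ pe; rewrite (itmor_path n.+1 pe) /left_half /right_half -catA.
rewrite [take _ _ ++ _]catA cat_take_drop -mor_cons -mor_cat; congr mor.
by rewrite -!catA.
Qed.

Lemma size_left_half e n : edge_path e ->
  size (left_half e n) = size (mor theta (itmor tau n [:: be])) + pointer e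
    n.+1.
Proof.
by case=> lt _; rewrite /left_half mor_cat !size_cat (size_takel (ltnW lt))
  /pointer addnA.
Qed.

Lemma left_half_long e n : n < size (left_half e n).
Proof.
rewrite /left_half mor_cat !size_cat -addnA ltn_addr //.
apply: leq_trans (size_itmor_gt Htau n (w := [:: be]) isT) _.
by have := size_mor_ge (itmor tau n [:: be]) theta0; rewrite muln1.
Qed.

Lemma right_half_long e n : n < size (right_half e n).
Proof.
rewrite /right_half mor_cat !size_cat addnA ltn_addl //.
apply: leq_trans (size_itmor_gt Htau n (w := [:: al]) isT) _.
by have := size_mor_ge (itmor tau n [:: al]) theta0; rewrite muln1.
Qed.

Lemma left_half_mono e n : suffix (left_half e n) (left_half e n.+1).
Proof.
rewrite /left_half; have -> : itmor tau n.+1 [:: be] ++ left_word e n.+2 =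
    itmor tau n.+1 (be :: take (e n.+2).2 (tau (e n.+2).1)) ++ left_word e n.+1.
  by rewrite -[be :: take _ _]cat1s itmor_cat [left_word e n.+2]/= -/(left_word
    e n.+1) catA.
have /suffixP[u ->] : suffix (itmor tau n [:: be])
    (itmor tau n.+1 (be :: take (e n.+2).2 (tau (e n.+2).1))) by exact:
      itmor_suffix1.
by rewrite -[(u ++ _) ++ _]catA [mor _ (u ++ _)]mor_cat -catA suffix_suffix.
Qed.

Lemma right_half_mono e n : prefix (right_half e n) (right_half e n.+1).
Proof.
rewrite /right_half; have -> : right_word e n.+2 ++ itmor tau n.+1 [:: al] =
    right_word e n.+1 ++ itmor tau n.+1 (rcons (drop (e n.+2).2.+1 (tau (e
      n.+2).1)) al).
  by rewrite -cats1 itmor_cat [right_word e n.+2]/= -/(right_word e n.+1) catA.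
have /prefixP[u ->] : prefix (itmor tau n [:: al])
    (itmor tau n.+1 (rcons (drop (e n.+2).2.+1 (tau (e n.+2).1)) al)).
  by apply: itmor_prefix1; rewrite -size_eq0 size_rcons.
by rewrite catA [mor _ (_ ++ u)]mor_cat catA prefix_prefix.
Qed.

Lemma point_occurs_left_half e n : occurs (path_point e) (- (size (left_half e
  n))%:Z)%R (left_half e n ++ right_half e n).
Proof.
apply: glue_occurs; [exact: left_half_mono|exact: right_half_mono|exact:
  left_half_long|exact: right_half_long].
Qed.

Lemma point_occurs e n : edge_path e ->
  occurs (path_point e) (- (size (mor theta (itmor tau n [:: be])) + pointer e
    n.+1)%N%:Z)%R
    (mor theta (itmor tau n [:: be] ++ itmor tau n.+1 [:: (e n.+1).1] ++ itmor
      tau n [:: al])).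
Proof. by move=> pe; rewrite -left_half_right_half // -size_left_half //;
  apply: point_occurs_left_half. Qed.

Lemma point_window e N : edge_path e -> exists n u v,
  mor theta (itmor tau n [:: be] ++ itmor tau n.+1 [:: (e n.+1).1] ++ itmor tau
    n [:: al]) =
    u ++ window (path_point e) (- N%:Z)%R (N + N) ++ v.
Proof.
move=> pe; exists N; rewrite -left_half_right_half //.
have [||u [v [-> _]]] := @window_inside _ _ _ _ (- N%:Z)%R (N + N)
  (point_occurs_left_half e N).
- by have := left_half_long e N; lia.
- by have := right_half_long e N; rewrite size_cat; lia.
- by exists u, v.
Qed.

Lemma point_codelang e t n : edge_path e -> codelang tau theta (window
  (path_point e) t n).
Proof.
move=> pe; pose N := absz t + n.
have [m [u [v ew]]] := point_window N pe.
exists m.+2, al; apply: infix_trans (infix_mor theta (extended_infix m (e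
  m.+1).1)).
rewrite ew; apply: infix_trans (infix_infix u _ v).
have [||u' [v' [-> _]]] := window_inside (s := t) (n :=
  n) (occurs_window (path_point e) (- N%:Z)%R (N + N)).
- by rewrite /N; lia.
- by rewrite size_window /N; lia.
- exact: infix_infix.
Qed.

Lemma pointer_shift e e' n k :
  (forall m, n < m -> e m = e' m) ->
  (pointer e' (n + k) + pointer e n = pointer e (n + k) + pointer e' n)%N.
Proof.
move=> ee; have [w [w1 w2]] := eq_left_word k ee.
by rewrite /pointer w1 w2 !mor_cat !size_cat; lia.
Qed.

(** Above level [n] both origins lie in the same blocks, and by [pointer_shift] their distance there
    does not depend on the level. *)
Lemma cofinal_shift e e' n : edge_path e -> edge_path e' ->
  (forall m, n < m -> e m = e' m) ->
  path_point e' = shiftby ((pointer e' n)%:Z - (pointer e n)%:Z)%R (path_point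
    e).
Proof.
move=> pe pe' ee; apply: occurs_eq => N.
pose m := (n + N + (pointer e n + pointer e' n))%N.
set K := size (mor theta (itmor tau m [:: be])).
have KN : m < K.
  apply: leq_trans (size_itmor_gt Htau m (w := [:: be]) isT) _.
  by have := size_mor_ge (itmor tau m [:: be]) theta0; rewrite muln1.
have BN : m < size (mor theta (itmor tau m [:: al])).
  apply: leq_trans (size_itmor_gt Htau m (w := [:: al]) isT) _.
  by have := size_mor_ge (itmor tau m [:: al]) theta0; rewrite muln1.
have em : m.+1 = (n + (m.+1 - n))%N by rewrite /m; lia.
have em' : e m.+1 = e' m.+1 by apply: ee; rewrite /m; lia.
have o := point_occurs m pe; have o' := point_occurs m pe'.
rewrite -em' in o'.
have ps := pointer_shift (m.+1 - n) ee; rewrite -em in ps.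
move: o'; set W := mor theta (_ ++ _) => o'.
exists (- (K + pointer e' m.+1)%N%:Z)%R, W; split=> //.
- by rewrite /m in KN; lia.
- have -> : W = left_half e' m ++ right_half e' m by rewrite
  left_half_right_half // -em'.
  have lt1 := right_half_long e' m; rewrite size_cat size_left_half // -/K.
  by have Nm : N <= m by [rewrite /m; lia]; move: Nm lt1; clear; lia.
- apply/occurs_shiftby; move: o; congr occurs.
  by rewrite -/K; lia.
Qed.

End Points.

End Paths.

Section Cut.
Context {R A : Type} (f : R -> seq A) (z : int -> R).
Local Open Scope ring_scope.

Definition cut_position (i : int) : int :=
  match i with
  | Posz n => (size (mor f (window z 0 n)))%:Z
  | Negz n => - (size (mor f (window z (Negz n) n.+1)))%:Z
  end.

Lemma cut_positionS i : cut_position (i + 1) = cut_position i + (size (f (z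
  i)))%:Z.
Proof.
case: i => [n|n].
  rewrite -[X in _ + X]/(1%:Z) -PoszD /= window_cat mor_cat size_cat PoszD
    add0r.
  by rewrite [window z _ 1]/= mor1 addr0.
have -> : Negz n + 1 = - n%:Z by rewrite NegzE; lia.
rewrite /cut_position -add1n window_cat mor_cat size_cat [window _ _ 1]/= mor1
  addr0.
have -> : Negz n + 1%:Z = - n%:Z by rewrite NegzE; lia.
rewrite PoszD opprD addrAC addNr add0r.
by case: n => [|n] //; rewrite -NegzE.
Qed.

Lemma cut_positionD i n : cut_position (i + n%:Z) = cut_position i + (size (mor
  f (window z i n)))%:Z.
Proof.
elim: n => [|n IH]; first by rewrite !addr0.
rewrite -addn1 window_cat mor_cat size_cat !PoszD addrA cut_positionS IH addrA.
by rewrite [window z _ 1]/= mor1 addr0.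
Qed.

End Cut.

Definition recognizable (R S : Type) (f : R -> seq S) :=
  forall (z z' : int -> R) (c c' : int -> int) x,
    decomp (f := f) z c x -> decomp (f := f) z' c' x ->
    (c 0 <= 0 < c 1)%R -> (c' 0 <= 0 < c' 1)%R -> (c 0 = c' 0)%R /\ z = z'.

Section Unfold.
Context {R : eqType} (tau : R -> seq R) (al be : R).
Context (Htau : full tau al be).
Implicit Types e : nat -> R * nat.

Definition reset e n := if n is 0 then ((e 0).1, 0) else e n.

(** The sequence over [R] that [theta] codes into the point of [e], as [decomp_point] shows.
    Resetting the bottom position lets single letters serve as bottom words. *)
Definition vertex_point e := path_point tau al be (fun r => [:: r]) al (reset
  e).

Lemma left_word_reset e n : left_word tau (reset e) n = left_word tau e n.
Proof. by elim: n => //= n ->. Qed.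

Lemma path_reset e : path_at tau e -> edge_path tau (fun r => [:: r]) (reset e).
Proof.
move=> pe; split=> // n; have := pe n.
by case: n => [|n] //= [lt e0]; split; rewrite // -{2}e0;
  apply: set_nth_default.
Qed.

Lemma vertex_point0 e : vertex_point e 0%R = (e 0).1. Proof. by []. Qed.

Lemma vertex_point_occurs e n : path_at tau e ->
  occurs (vertex_point e) (- (size (itmor tau n [:: be] ++ left_word tau e
    n.+1))%:Z)%R
    (itmor tau n [:: be] ++ itmor tau n.+1 [:: (e n.+1).1] ++ itmor tau n [::
      al]).
Proof.
move=> pe; have := point_occurs Htau (theta :=
  fun r => [:: r]) al (fun r => isT) n (path_reset pe).
by rewrite /pointer left_word_reset !mor_id addn0 size_cat.
Qed.

Lemma tau_gt0 r : 0 < size (tau r).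
Proof. exact: ltn_trans (full_size Htau r). Qed.

Lemma path_tailP e : path_at tau e -> edge_path tau tau (path_tail e).
Proof. by move=> pe; split; [have [] := pe 0|apply: path_at_tail]. Qed.

(** Makes recognition recursive: the sequence of bottom vertices is the point of the tail, with
    [tau] in the role of [theta]. *)
Lemma vertex_point_tail e : path_at tau e ->
  vertex_point e = path_point tau al be tau al (path_tail e).
Proof.
move=> pe; apply: occurs_eq => N.
have := point_occurs Htau al tau_gt0 N (path_tailP pe).
have := vertex_point_occurs N.+1 pe; set w := itmor _ _ _ ++ _.
have -> : mor tau (itmor tau N [:: be] ++ itmor tau N.+1 [:: (path_tail e
  N.+1).1] ++
   itmor tau N [:: al]) = itmor tau N.+1 [:: be] ++ itmor tau N.+2 [:: (e
     N.+2).1] ++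
   itmor tau N.+1 [:: al] by rewrite !mor_cat.
have <- : size w = size (mor tau (itmor tau N [:: be])) + pointer tau tau
  (path_tail e) N.+1.
  rewrite /w left_word_tail size_cat /pointer addnA size_cat size_takel ?addnA
    //.
  by have [/ltnW] := pe 0.
set W := _ ++ _ ++ _ => o1 o2; exists (- (size w)%:Z)%R, W; split=> //.
- have := size_itmor_gt Htau N.+1 (w := [:: be]) isT.
  by rewrite /w size_cat; lia.
- rewrite /W (itmor_path N.+2 pe) !size_cat /=.
  by have := size_itmor_gt Htau N.+1 (w := [:: al]) isT; lia.
Qed.

Context {A : eqType} (theta : R -> seq A) (a0 : A).
Context (theta0 : forall r, 0 < size (theta r)).

Lemma decomp_point e : edge_path tau theta e ->
  decomp (f := theta) (vertex_point e)
    (fun i => cut_position theta (vertex_point e) i - (e 0).2%:Z)%R (path_point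
      tau al be theta a0 e).
Proof.
move=> pe i; have [_ pae] := pe.
split; first by rewrite cut_positionS addrAC.
pose n := absz i; set z := vertex_point e.
pose w0 := itmor tau n [:: be] ++ left_word tau e n.+1.
have szw0 : n < size w0.
  by rewrite size_cat ltn_addr //; exact: (size_itmor_gt Htau n (w := [:: be])).
have := vertex_point_occurs n pae; rewrite -/z -/w0; set w := _ ++ _ => oz.
have ew : w = w0 ++ (e 0).1 :: right_word tau e n.+1 ++ itmor tau n [:: al].
  by rewrite /w (itmor_path n.+1 pae) /w0 -!catA.
have [||u [v [euv iu]]] := @window_inside _ _ _ _ i 1 oz.
- by rewrite /n in szw0; lia.
- rewrite ew !size_cat /= !size_cat.
  by have := size_itmor_gt Htau n (w := [:: al]) isT; rewrite /n; lia.
have eu : window z (- (size w0)%:Z)%R (size u) = u.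
  by move: oz; rewrite euv => /occurs_cat[].
have ew0 : window z (- (size w0)%:Z)%R (size w0) = w0.
  by move: oz; rewrite ew => /occurs_cat[].
have c1 := cut_positionD theta z (- (size w0)%:Z)%R (size u).
have c2 := cut_positionD theta z (- (size w0)%:Z)%R (size w0).
rewrite addNr ew0 /= in c2; rewrite iu eu in c1.
have := point_occurs Htau a0 theta0 n pe; rewrite -/w euv !mor_cat =>
  /occurs_sub.
rewrite [window z i 1]/= mor1 addr0; congr occurs.
have e3 : size (mor theta w0) =
    size (mor theta (itmor tau n [:: be])) + size (mor theta (left_word tau e
      n.+1)).
  by rewrite /w0 mor_cat size_cat.
move/esym/eqP: c2; rewrite addr_eq0 => /eqP c2.
rewrite c1 c2 /pointer e3; move: (size (mor theta u)) => k1.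
by move: (size _) (size _) (e 0).2 => k2 k3 k4; clear; lia.
Qed.

Lemma cut_point0 e : edge_path tau theta e ->
  (cut_position theta (vertex_point e) 0 - (e 0).2%:Z <= 0 < cut_position theta
    (vertex_point e) 1 - (e 0).2%:Z)%R.
Proof.
case=> lt _; have := cut_positionS theta (vertex_point e) 0;
  rewrite add0r vertex_point0 => ->.
have -> : cut_position theta (vertex_point e) 0 = 0%R by [].
by rewrite !add0r oppr_le0 subr_gt0 ltz_nat lt.
Qed.

Lemma point_eq e e' : recognizable theta -> edge_path tau theta e ->
  edge_path tau theta e' ->
  path_point tau al be theta a0 e = path_point tau al be theta a0 e' ->
  (e 0).2 = (e' 0).2 /\ vertex_point e = vertex_point e'.
Proof.
move=> rec pe pe' ee; have d := decomp_point pe; have d' := decomp_point pe'.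
rewrite -ee in d'.
have [c0 zz] := rec _ _ _ _ _ d d' (cut_point0 pe) (cut_point0 pe').
split=> //; move: c0.
have c00 z : cut_position theta z 0 = 0%R by [].
by rewrite !c00 !add0r => /oppr_inj[].
Qed.

End Unfold.

(** Recognizability of [theta] yields the lowest edge, that of [tau] then each further one. *)
Lemma point_inj (R A : eqType) (tau : R -> seq R) (al be : R)
  (theta : R -> seq A) (a0 : A) (e e' : nat -> R * nat) : full tau al be ->
  (forall r, 0 < size (theta r)) -> recognizable theta -> recognizable tau ->
  edge_path tau theta e -> edge_path tau theta e' ->
  path_point tau al be theta a0 e = path_point tau al be theta a0 e' -> e = e'.
Proof.
move=> Htau theta0 rec_theta rec_tau pe pe' ee.
have eq0 (f f' : nat -> R * nat) : (f 0).2 = (f' 0).2 ->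
  vertex_point tau al be f = vertex_point tau al be f' -> f 0 = f' 0.
  move=> e2 ez; have := congr1 (fun z : int -> R => z 0%R) ez;
    rewrite !vertex_point0 => e1.
  by case: (f 0) (f' 0) e1 e2 => [? ?] [? ?] /= -> ->.
have [e2 ez] := point_eq Htau theta0 rec_theta pe pe' ee.
have [_ pae] := pe; have [_ pae'] := pe'.
have {pe pe' ee} H n : forall f f', path_at tau f -> path_at tau f' ->
    (f 0).2 = (f' 0).2 -> vertex_point tau al be f = vertex_point tau al be f'
      -> f n = f' n.
  elim: n => [|n IH] f f' pf pf' f2 fz; first exact: eq0.
  have := fz; rewrite !(vertex_point_tail Htau) // => fz'.
  have [e2' ez'] := point_eq Htau (tau_gt0 Htau) rec_tau (path_tailP pf)
    (path_tailP pf') fz'.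
  by apply: (IH (path_tail f) (path_tail f')) => //; apply: path_at_tail.
by apply: funext => n; apply: H.
Qed.

(** * Tail equivalence of paths and orbits of points *)

Section Orbits.
Context {R : eqType} (tau : R -> seq R) (al be : R).
Context (Htau : full tau al be).
Context {A : eqType} (theta : R -> seq A) (a0 : A).
Context (theta0 : forall r, 0 < size (theta r)).
Implicit Types e : nat -> R * nat.

Local Notation pt := (path_point tau al be theta a0).
Local Notation ptr := (pointer tau theta).
Local Notation edge_path := (edge_path tau theta).

Lemma nth_first d r : nth d (tau r) 0 = al.
Proof. by have [s [-> _]] := Htau r. Qed.

Lemma nth_final d r : nth d (tau r) (size (tau r)).-1 = be.
Proof.
by have [s [-> _]] := Htau r; rewrite nth_last /= last_rcons.
Qed.

Definition emin (n : nat) : R * nat := (al, 0).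

Definition emax (n : nat) : R * nat :=
  if n is 0 then (be, (size (theta be)).-1) else (be, (size (tau be)).-1).

Lemma path_emin : edge_path emin.
Proof.
split; first exact: theta0.
by move=> n; rewrite (tau_gt0 Htau) nth_first.
Qed.

Lemma path_emax : edge_path emax.
Proof.
split; first by rewrite prednK.
move=> n; split; first by rewrite prednK // (tau_gt0 Htau).
by rewrite nth_final; case: n.
Qed.

(** Minimal below the vertex [r] at level [n], then through the edge at position [k] into the path
    [e]. *)
Definition graft e n r k m : R * nat :=
  if m < n then (al, 0) else if m == n then (r, 0)
  else if m == n.+1 then ((e m).1, k) else e m.

Lemma graft_lt e n r k m : m < n -> graft e n r k m = (al, 0).
Proof. by rewrite /graft => ->. Qed.

Lemma graft_eq e n r k : graft e n r k n = (r, 0).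
Proof. by rewrite /graft ltnn eqxx. Qed.

Lemma graft_S e n r k : graft e n r k n.+1 = ((e n.+1).1, k).
Proof. by rewrite /graft ltnNge leqnSn /= gtn_eqF // eqxx. Qed.

Lemma graft_gt e n r k m : n.+1 < m -> graft e n r k m = e m.
Proof.
move=> nm; rewrite /graft ltnNge (ltnW (ltnW nm)) /= !gtn_eqF //.
exact: ltnW.
Qed.

Lemma path_graft e n r k : path_at tau e -> k < size (tau (e n.+1).1) ->
  nth r (tau (e n.+1).1) k = r -> edge_path (graft e n r k).
Proof.
move=> pe kt kr; split.
  case: n {kt kr} => [|n]; first by rewrite graft_eq; apply: theta0.
  by rewrite graft_lt //; apply: theta0.
move=> m; have [mn|mn|->] := ltngtP m n.
- rewrite [X in nth X.1]graft_lt // [X in _ = X.1]graft_lt //.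
  move: mn; rewrite leq_eqVlt => /orP[/eqP <-|mn].
    by rewrite graft_eq (tau_gt0 Htau) nth_first.
  by rewrite graft_lt // (tau_gt0 Htau) nth_first.
- have -> : graft e n r k m.+1 = e m.+1 by apply: graft_gt.
  move: mn; rewrite leq_eqVlt => /orP[/eqP <-|mn].
    rewrite graft_S; case: (pe n.+1) => lt e1; split; first exact: lt.
    by rewrite -[RHS]e1; apply: set_nth_default.
  by rewrite graft_gt //; apply: pe.
- by rewrite graft_S graft_eq.
Qed.

(** The letter of [tau (e n.+1).1] whose block contains position [t] fixes the edge at level [n.+1];
    the induction hypothesis for a grafted path settles the lower levels. *)
Lemma path_rebuild n t e : path_at tau e ->
  t < size (mor theta (itmor tau n [:: (e n).1])) ->
  exists e', [/\ edge_path e', forall m, n < m -> e m = e' m,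
                 (e' n).1 = (e n).1 & ptr e' n = t].
Proof.
elim: n t e => [|n IH] t e pe tlt.
  exists (fun m => if m is 0 then ((e 0).1, t) else e m); split=> //.
    split=> [|[|m]]; [by move: tlt; rewrite mor1|exact: pe|exact: pe].
  by case.
move: tlt; rewrite itmorSr mor1 itmor_mor mor_comp => /mor_split[w1 [r [w2 [ew
  /andP[le lt]]]]].
rewrite /= in lt.
have kt : size w1 < size (tau (e n.+1).1) by rewrite ew size_cat /=; lia.
have kr : nth r (tau (e n.+1).1) (size w1) = r by rewrite ew nth_cat ltnn subnn.
have [_ pe1] := path_graft pe kt kr.
set K := size (mor _ w1) in le lt.
have [|e' [pe' ee' _ pt']] := IH (t - K) _ pe1.
  by rewrite graft_eq /= ltn_subLR.
have en1 : e' n.+1 = ((e n.+1).1, size w1) by rewrite -ee' // graft_S.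
exists e'; split=> //.
- by move=> m nm; rewrite -ee' ?graft_gt // ltnW.
- by rewrite en1.
- move: pt'; rewrite /pointer /= en1 /= ew take_size_cat // mor_cat size_cat.
  by rewrite [itmor _ _ w1]itmor_mor mor_comp -/K; move: le; clear; lia.
Qed.

Lemma path_through c n : exists2 e, path_at tau e & (e n).1 = c.
Proof.
have cm : c \in tau al by exact: full_mem Htau _ _.
have [_ pe] : edge_path (graft emin n c (index c (tau al))).
  by apply: path_graft; [case: path_emin|rewrite index_mem|rewrite nth_index].
by eexists; [exact: pe|rewrite graft_eq].
Qed.

Lemma occurs_pointer e n : edge_path e ->
  occurs (pt e) (- (ptr e n)%:Z)%R (mor theta (itmor tau n [:: (e n).1])).
Proof.
move=> pe; have := point_occurs Htau a0 theta0 n pe; case: pe => _ pe.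
rewrite (itmor_path n.+1 pe) /=.
set X := itmor tau n (take _ _); set Y := itmor tau n (drop _ _).
have -> : itmor tau n [:: be] ++ ((X ++ left_word tau e n) ++ (e 0).1 ::
  right_word tau e n ++ Y) ++
   itmor tau n [:: al] = (itmor tau n [:: be] ++ X) ++ itmor tau n [:: (e n).1]
     ++
   (Y ++ itmor tau n [:: al]).
  by rewrite (itmor_path n pe) -!catA /= -!catA.
rewrite [mor theta (_ ++ _)]mor_cat [mor theta (itmor _ _ [:: (e n).1] ++
  _)]mor_cat.
move/occurs_sub; congr occurs.
rewrite /pointer /= -/X !mor_cat !size_cat.
by move: (size _) (size _) (size _) (e 0).2 => i j k l; clear; lia.
Qed.

Lemma path_approx (x : int -> A) N :
  (forall t n, codelang tau theta (window x t n)) ->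
  exists2 e, edge_path e & window (pt e) (- N%:Z)%R (N + N).+1 =
                      window x (- N%:Z)%R (N + N).+1.
Proof.
move=> /(_ (- N%:Z)%R (N + N).+1)[n [c]]; set w := window x _ _.
case/infixP=> u [v ew]; have [e pe ec] := path_through c n.
have mor_ : size w = (N + N).+1 by rewrite size_window.
(* The origin is placed at the centre of the window, [N] letters after its start. *)
have [|e' [pe' ee' ec' pte']] := @path_rebuild n (size u + N) e pe.
  by rewrite ec ew !size_cat mor_; clear; lia.
exists e' => //; have := occurs_pointer n pe';
  rewrite ec' ec ew pte' => /occurs_sub.
have -> : (- (size u + N)%N%:Z + (size u)%:Z = - N%:Z)%R by clear; lia.
by rewrite /occurs mor_.
Qed.

Lemma pointer_lt e n : edge_path e -> ptr e n < size (mor theta (itmor tau n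
  [:: (e n).1])).
Proof.
case=> lt pe; rewrite (itmor_path n pe) mor_cat size_cat mor_cons size_cat
  /pointer.
by rewrite ltn_add2l ltn_addr.
Qed.

Definition cofinal e e' := exists n, forall m, n < m -> e m = e' m.

Definition evmax e := exists n, forall m, n < m ->
  (e m).2.+1 = size (tau (e m).1).

Definition evmin e := exists n, forall m, n < m -> (e m).2 = 0.

Definition same_orbit (x y : int -> A) := exists d, y = shiftby d x.

Lemma same_orbit_trans x y z : same_orbit x y -> same_orbit y z ->
  same_orbit x z.
Proof.
move=> [d ->] [d' ->]; exists (d' + d)%R; apply: funext => i.
by rewrite /shiftby addrA.
Qed.

Lemma same_orbit_sym x y : same_orbit x y -> same_orbit y x.
Proof.
move=> [d ->]; exists (- d)%R; apply: funext => i.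
by rewrite /shiftby subrK.
Qed.

Lemma cofinal_orbit e e' : edge_path e -> edge_path e' -> cofinal e e' ->
  same_orbit (pt e) (pt e').
Proof.
move=> pe pe' [n ee]; exists ((ptr e' n)%:Z - (ptr e n)%:Z)%R.
exact: cofinal_shift.
Qed.

Lemma evmax_cofinal e : edge_path e -> evmax e -> cofinal e emax.
Proof.
move=> [_ pe] [n en]; exists n => m nm.
have em1 : (e m).1 = be.
  have [_ <-] := pe m; rewrite -(nth_final (e m).1 (e m.+1).1).
  by rewrite -(en m.+1 (ltnW nm)).
have := en m nm; case: (e m) em1 => r k /= ->; case: m nm => // m _ ek.
by rewrite /emax -ek.
Qed.

Lemma evmin_cofinal e : edge_path e -> evmin e -> cofinal e emin.
Proof.
move=> [_ pe] [n en]; exists n => m nm.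
have em1 : (e m).1 = al.
  by have [_ <-] := pe m; rewrite (en m.+1 (ltnW nm)) nth_first.
by have := en m nm; case: (e m) em1 => r k /= -> ->.
Qed.

Lemma left_word_emin n : left_word tau emin n = [::].
Proof.
elim: n => //= n ->; rewrite take0 cats0.
by rewrite itmor_mor.
Qed.

Lemma right_word_emax n : right_word tau emax n = [::].
Proof.
elim: n => //= n ->; rewrite prednK ?(tau_gt0 Htau) // drop_size.
by rewrite itmor_mor.
Qed.

(** Around the origin both points read the image of [tau^N(be)] followed by that of [tau^N(al)]. The
    origin is the first letter after the junction for [emin] and the last one before it for
    [emax]. *)
Lemma emin_emax : pt emin = shiftby 1 (pt emax).
Proof.
apply: occurs_eq => N.
pose b := itmor tau N [:: be]; pose a := itmor tau N [:: al].
have bN : N < size (mor theta b).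
  apply: leq_trans (size_itmor_gt Htau N (w := [:: be]) isT) _.
  by have := size_mor_ge b theta0; rewrite muln1.
have aN : N < size (mor theta a).
  apply: leq_trans (size_itmor_gt Htau N (w := [:: al]) isT) _.
  by have := size_mor_ge a theta0; rewrite muln1.
exists (- (size (mor theta b))%:Z)%R, (mor theta (b ++ a)); split.
- by move: bN; clear; lia.
- by rewrite mor_cat size_cat; move: aN; clear; lia.
- have := point_occurs Htau a0 theta0 N path_emin.
  rewrite /pointer left_word_emin addn0 -/b -/a [(emin _).1]/=.
  have /prefixP[v ->] : prefix a (itmor tau N.+1 [:: al]) by apply:
    itmor_prefix1.
  by rewrite -catA catA mor_cat => /occurs_cat[].
- have := point_occurs Htau a0 theta0 N path_emax;
  rewrite -/b -/a [(emax _).1]/=.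
  have eb : itmor tau N.+1 [:: be] = left_word tau emax N.+1 ++ [:: be].
    by have [_ pe] := path_emax; rewrite (itmor_path N.+1 pe) right_word_emax.
  have /suffixP[v ev] : suffix b (itmor tau N.+1 [:: be]) by apply:
    itmor_suffix1.
  have es : size (mor theta (itmor tau N.+1 [:: be])) = (ptr emax N.+1).+1.
    rewrite eb mor_cat size_cat mor1 /pointer /= -addnS prednK //.
  move: es; rewrite ev -catA catA mor_cat size_cat => es.
  rewrite [mor theta ((b ++ v) ++ _)]mor_cat => /occurs_cat[_ o];
    apply/occurs_shiftby.
  move: o es; rewrite mor_cat size_cat; set p := size _; set q := size _.
  move=> o es; move: o; congr occurs; move: es; rewrite -/p.
  by move: p q (ptr emax N.+1) => p q r; clear; lia.
Qed.

(** Extremality is expressed by positions of edges instead of the paths [emin] and [emax], so that a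
    permutation of interior edges visibly preserves it. *)
Definition related e e' := [\/ cofinal e e', evmax e /\ evmin e' | evmin e /\
  evmax e'].

(** Every edge that is not maximal adds letters on the right. Hence a shift by [d] stays inside some
    block of the path, which is how [shift_up] remains cofinal. *)
Lemma right_word_long e d : path_at tau e -> ~ evmax e ->
  exists n, d <= size (right_word tau e n).
Proof.
move=> pe nmax; elim: d => [|d [n dn]]; first by exists 0.
have [m [nm em]] : exists m, n < m /\ (e m).2.+1 <> size (tau (e m).1).
  apply: contrapT => H; apply: nmax; exists n => m nm.
  by apply: contrapT => em; apply: H; exists m.
have mono k : size (right_word tau e n) <= size (right_word tau e (n + k)).
  by elim: k => [|k IH]; rewrite ?addn0 // addnS /= size_cat;
    rewrite (leq_trans IH) ?leq_addr.
case: m nm em => // m nm em; exists m.+1.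
rewrite /= size_cat; apply: leq_ltn_trans dn _.
apply: leq_ltn_trans (mono (m - n)) _; rewrite subnKC // -addn1 leq_add2l.
have : drop (e m.+1).2.+1 (tau (e m.+1).1) != [::].
  by rewrite -size_eq0 size_drop; have [lt _] := pe m; move: lt em; clear; lia.
by move/(size_itmor_gt Htau m); apply: leq_trans.
Qed.

Lemma left_word_long e d : path_at tau e -> ~ evmin e ->
  exists n, d <= size (left_word tau e n).
Proof.
move=> pe nmin; elim: d => [|d [n dn]]; first by exists 0.
have [m [nm em]] : exists m, n < m /\ (e m).2 <> 0.
  apply: contrapT => H; apply: nmin; exists n => m nm.
  by apply: contrapT => em; apply: H; exists m.
have mono k : size (left_word tau e n) <= size (left_word tau e (n + k)).
  by elim: k => [|k IH]; rewrite ?addn0 // addnS /= size_cat;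
    rewrite (leq_trans IH) ?leq_addl.
case: m nm em => // m nm em; exists m.+1.
rewrite /= size_cat; apply: leq_ltn_trans dn _.
apply: leq_ltn_trans (mono (m - n)) _; rewrite subnKC // -add1n leq_add2r.
have : take (e m.+1).2 (tau (e m.+1).1) != [::].
  rewrite -size_eq0 size_takel; first by apply/eqP.
  by have [/ltnW] := pe m.
by move/(size_itmor_gt Htau m); apply: leq_trans.
Qed.

Lemma shift_up e (d : nat) : edge_path e -> ~ evmax e ->
  exists e', [/\ edge_path e', cofinal e e' & pt e' = shiftby d%:Z (pt e)].
Proof.
move=> pe nmax; have [lt pae] := pe; have [n dn] := right_word_long d pae nmax.
have [|e' [pe' ee' _ pte']] := @path_rebuild n (ptr e n + d) e pae.
  rewrite (itmor_path n pae) mor_cat size_cat mor_cons size_cat /pointer.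
  have := size_mor_ge (right_word tau e n) theta0; rewrite muln1; move: lt dn.
  by move: (size _) (size _) (size _) (size _) (e 0).2 => i j k l m; clear; lia.
exists e'; split=> //; first by exists n.
rewrite (cofinal_shift Htau a0 theta0 pe pe' ee') pte';
  apply: (congr1 (fun k => shiftby k (pt e))).
by move: (ptr e n) => k; clear; lia.
Qed.

Lemma shift_down e (d : nat) : edge_path e -> ~ evmin e ->
  exists e', [/\ edge_path e', cofinal e e' & pt e' = shiftby (- d%:Z)%R (pt
    e)].
Proof.
move=> pe nmin; have [lt pae] := pe; have [n dn] := left_word_long d pae nmin.
have [|e' [pe' ee' _ pte']] := @path_rebuild n (ptr e n - d) e pae.
  by apply: leq_ltn_trans (pointer_lt n pe); rewrite leq_subr.
exists e'; split=> //; first by exists n.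
rewrite (cofinal_shift Htau a0 theta0 pe pe' ee') pte';
  apply: (congr1 (fun k => shiftby k (pt e))).
have : d <= ptr e n.
  apply: leq_trans dn _; rewrite /pointer.
  have := size_mor_ge (left_word tau e n) theta0; rewrite muln1 => /leq_trans;
    apply.
  exact: leq_addr.
by move: (ptr e n) => k; clear; lia.
Qed.

Context (pt_inj : forall e e', edge_path e -> edge_path e' ->
  pt e = pt e' -> e = e').

Lemma cofinal_sym e e' : cofinal e e' -> cofinal e' e.
Proof. by case=> n ee; exists n => m nm; rewrite ee. Qed.

(* An orbit is a class of the tail equivalence, except that the classes of the
   minimal and of the maximal path are joined. *)
Lemma orbit_related e e' : edge_path e -> edge_path e' ->
  same_orbit (pt e) (pt e') <-> related e e'.
Proof.
move=> pe pe'; split.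
- have up f f' (d : nat) : edge_path f -> edge_path f' ->
  pt f' = shiftby d%:Z (pt f) ->
      cofinal f f' \/ (evmax f /\ evmin f').
    (* A shift to the right that leaves every common block can only start at an eventually maximal
       path and end at an eventually minimal one. *)
    move=> pf pf' ff'; have [fmax|nmax] := pselect (evmax f); last first.
      have [g [pg fg ptg]] := shift_up d pf nmax; left.
      by rewrite -(pt_inj pg pf') // ptg ff'.
    have [fmin|nmin] := pselect (evmin f'); first by right.
    have [g [pg fg ptg]] := shift_down d pf' nmin; left; apply: cofinal_sym.
    rewrite -(pt_inj pg pf) // ptg ff'; apply: funext => i.
    by rewrite /shiftby subrK.
  case=> -[d|d] ed.
    by have [|] := up _ _ _ pe pe' ed; [constructor 1|constructor 2].
  have [|/cofinal_sym|[]] := up e' e d.+1 pe' pe;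
    [|by constructor 1|by constructor 3].
  rewrite ed; apply: funext => i; rewrite /shiftby NegzE.
  by congr (pt e _); clear; lia.
- case=> [|[/(evmax_cofinal pe) ce /(evmin_cofinal pe') ce']|
          [/(evmin_cofinal pe) ce /(evmax_cofinal pe') ce']].
  + exact: cofinal_orbit.
  + apply: same_orbit_trans (cofinal_orbit pe path_emax ce) _.
    apply: same_orbit_trans (same_orbit_sym (cofinal_orbit pe' path_emin ce')).
    by exists 1%R; apply: emin_emax.
  + apply: same_orbit_trans (cofinal_orbit pe path_emin ce) _.
    apply: same_orbit_trans (same_orbit_sym (cofinal_orbit pe' path_emax ce')).
    by apply: same_orbit_sym; exists 1%R; apply: emin_emax.
Qed.

End Orbits.

(** An isomorphism of diagrams that forgets the order of the edges except for the extremal ones. *)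
Definition edge_perm (R : eqType) (tau tau' : R -> seq R) (rho rho' : R ->
  nat -> nat) :=
  forall r k, k < size (tau r) ->
    [/\ rho r k < size (tau' r), rho' r (rho r k) = k,
        forall d, nth d (tau' r) (rho r k) = nth d (tau r) k,
        k = 0 -> rho r k = 0 &
        k.+1 = size (tau r) -> (rho r k).+1 = size (tau' r)].

Lemma perm_positions (T : eqType) (s s' : seq T) : perm_eq s s' ->
  exists p p' : nat -> nat,
    (forall k, k < size s -> [/\ p k < size s', p' (p k) = k &
       forall d, nth d s' (p k) = nth d s k]) /\
    (forall k, k < size s' -> [/\ p' k < size s, p (p' k) = k &
       forall d, nth d s (p' k) = nth d s' k]).
Proof.
case: s' => [|x0 s'].
  by move/perm_nilP=> ->; exists id, id.
set t := x0 :: s'; move=> pst; have sz := perm_size pst.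
have /(perm_iotaP x0)[Is pI es] := pst.
have szI : size Is = size t by rewrite -sz es size_map.
have uI : uniq Is by rewrite (perm_uniq pI) iota_uniq.
have memI k : (k \in Is) = (k < size t) by rewrite (perm_mem pI) mem_iota.
have nthI k d : k < size t -> nth d t (nth 0 Is k) = nth d s k.
  move=> kt; have kI : nth 0 Is k < size t by rewrite -memI mem_nth // szI.
  rewrite (set_nth_default x0) // [RHS](set_nth_default x0) ?sz //.
  by rewrite es (nth_map 0) // szI.
exists (nth 0 Is), (index^~ Is); rewrite sz; split=> k kt.
- split; [by rewrite -memI mem_nth // szI|by rewrite index_uniq // szI|].
  by move=> d; apply: nthI.
- have kI : k \in Is by rewrite memI.
  split; [by rewrite -szI index_mem|exact: nth_index|].
  by move=> d; rewrite -nthI ?nth_index // -szI index_mem.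
Qed.

Lemma edge_perm_exists (R : finType) (tau tau' : R -> seq R) (al be : R) :
  (forall c, exists s s', [/\ tau c = al :: rcons s be,
     tau' c = al :: rcons s' be & perm_eq s s']) ->
  exists rho rho', edge_perm tau tau' rho rho' /\ edge_perm tau' tau rho' rho.
Proof.
move=> H; pose P c (u : (nat -> nat) * (nat -> nat)) :=
  (forall k, k < size (tau c) ->
    [/\ u.1 k < size (tau' c), u.2 (u.1 k) = k,
        forall d, nth d (tau' c) (u.1 k) = nth d (tau c) k,
        k = 0 -> u.1 k = 0 &
        k.+1 = size (tau c) -> (u.1 k).+1 = size (tau' c)]) /\
  (forall k, k < size (tau' c) ->
    [/\ u.2 k < size (tau c), u.1 (u.2 k) = k,
        forall d, nth d (tau c) (u.2 k) = nth d (tau' c) k,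
        k = 0 -> u.2 k = 0 &
        k.+1 = size (tau' c) -> (u.2 k).+1 = size (tau c)]).
have /fin_all_exists[u uP] : forall c, exists u, P c u.
  move=> c; have [s [s' [es es' pss']]] := H c; have sz := perm_size pss'.
  have [p [p' [pP pP']]] := perm_positions pss'.
  (* Interior letters start at position 1, so the permutation is moved by one; the first and the
     last position stay fixed. *)
  pose ext (q : nat -> nat) k := if k is k'.+1 then
    if k' < size s then (q k').+1 else k else 0.
  exists (ext p, ext p'); rewrite /P es es' /= !size_rcons -sz.
  have nth_ext (q : nat -> nat) (w w' : seq R) k d : size w = size s ->
    size w' = size s ->
      (forall k, k < size s -> q k < size s /\ nth d w' (q k) = nth d w k) ->
      nth d (al :: rcons w' be) (ext q k) = nth d (al :: rcons w be) k.
    case: k => //= k mor sw' qP; case: ltnP => /= ks.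
      by have [qk e] := qP k ks; rewrite !nth_rcons mor sw' ks qk e.
    by rewrite !nth_rcons mor sw' ltnNge ks.
  have ext_pos (q q' : nat -> nat) k :
      (forall k, k < size s -> q k < size s /\ q' (q k) = k) ->
      k < (size s).+2 -> [/\ ext q k < (size s).+2, ext q' (ext q k) = k &
        k.+1 = (size s).+2 -> (ext q k).+1 = (size s).+2].
    case: k => [|k] qP kn; first by split.
    rewrite /ext; have [ks|sk] := boolP (k < size s).
      by have [lt e] := qP k ks; rewrite lt e; split=> //; lia.
    by rewrite (negPf sk); split.
  split=> k ks.
  - have [|lt eK last_] := ext_pos p p' k _ ks.
      by move=> k' ks'; have [lt e _] := pP k' ks'; rewrite sz.
    split=> // [d|->] //; apply: nth_ext => // k' ks'.
    by have [lt' _ e] := pP k' ks'; rewrite sz lt' e.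
  - have [|lt eK last_] := ext_pos p' p k _ ks.
      by move=> k' ks'; have [|lt e _] := pP' k'; rewrite -?sz.
    split=> // [d|->] //; apply: nth_ext => // k' ks'.
    by have [|lt' _ e] := pP' k'; rewrite -?sz // lt' e.
by exists (fun c => (u c).1), (fun c => (u c).2); split=> c; have [] := uP c.
Qed.

Section Relabel.
Context {R : eqType} {tau tau' : R -> seq R} {al be : R}.
Context {rho rho' : R -> nat -> nat}.
Context (Hrho : edge_perm tau tau' rho rho').
Implicit Types e : nat -> R * nat.

(** Level 0 is left alone: its positions lie in bottom words, whose lengths agree on both sides. *)
Definition relabel (rho : R -> nat -> nat) e n : R * nat :=
  if n is 0 then e 0 else ((e n).1, rho (e n).1 (e n).2).

Lemma relabel1 r e n : (relabel r e n).1 = (e n).1. Proof. by case: n. Qed.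

Lemma relabel_path (A A' : eqType) (theta : R -> seq A) (theta' : R ->
  seq A') e :
  (forall r, size (theta' r) = size (theta r)) ->
  edge_path tau theta e -> edge_path tau' theta' (relabel rho e).
Proof.
move=> sz [lt pe]; split; first by rewrite /= sz.
move=> n; have [en e1] := pe n; rewrite !relabel1 /=.
have [rk _ nthk _ _] := Hrho en; split=> //.
by rewrite nthk.
Qed.

Lemma relabelK e : path_at tau e -> relabel rho' (relabel rho e) = e.
Proof.
move=> pe; apply: funext => -[//|n] /=.
have [en e1] := pe n; have [_ -> _ _ _] := Hrho en.
by case: (e n.+1).
Qed.

Lemma relabel_related e e' : path_at tau e -> path_at tau e' ->
  related tau e e' -> related tau' (relabel rho e) (relabel rho e').
Proof.
have minP f : path_at tau f -> evmin f -> evmin (relabel rho f).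
  move=> pf [n fn]; exists n => -[//|m] nm /=; have [lt _] := pf m.
  by have [_ _ _ + _] := Hrho lt; apply; apply: fn.
have maxP f : path_at tau f -> evmax tau f -> evmax tau' (relabel rho f).
  move=> pf [n fn]; exists n => -[//|m] nm /=; have [lt _] := pf m.
  by have [_ _ _ _] := Hrho lt; apply; apply: fn.
move=> pe pe' [[n ee]|[e1 e2]|[e1 e2]].
- constructor 1; exists n => m nm; case: m nm => // m nm.
  by rewrite /relabel ee.
- by constructor 2; split; [apply: maxP|apply: minP].
- by constructor 3; split; [apply: minP|apply: maxP].
Qed.

End Relabel.

Local Open Scope classical_set_scope.

(** * Topology of the path space *)

Section DiscreteProduct.
Context {I : eqType} {K : choiceType}.
Local Notation PK := {ptws I -> discrete_topology K}.

Lemma nbhs_agree (x : PK) (s : seq I) :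
  nbhs x [set y : PK | forall i, i \in s -> y i = x i].
Proof.
elim: s => [|i s IH].
  by apply: filterS (filterT : nbhs x setT) => y _ i; rewrite in_nil.
have Hi : nbhs x [set y : PK | y i = x i].
  have := @proj_continuous I (fun=> discrete_topology K) i x.
  move=> /(_ [set x i]); apply.
  by rewrite nbhs_principalE; apply/principal_filterP.
apply: filterS (filterI Hi IH) => y /= [yi ys] j;
  rewrite inE => /orP[/eqP->//|].
exact: ys.
Qed.

Lemma ptws_hausdorff : hausdorff_space PK.
Proof. by apply: hausdorff_product => i; apply: discrete_hausdorff. Qed.

(** Otherwise points that agree with [x] on [J n] but lie outside [U] would form a sequence
    converging to [x]. *)
Lemma nbhs_coord (x : PK) (U : set PK) (J : nat -> seq I) :
  (forall i, exists n, forall m, (n <= m)%N -> i \in J m) -> nbhs x U ->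
  exists n, forall y : PK, (forall i, i \in J n -> y i = x i) -> U y.
Proof.
move=> JP xU; apply: contrapT => H.
have /choice[y yP] : forall n, exists y : PK,
    (forall i, i \in J n -> y i = x i) /\ ~ U y.
  move=> n; apply: contrapT => Hn; apply: H; exists n => y yx.
  by apply: contrapT => Uy; apply: Hn; exists y.
have : y n @[n --> \oo] --> x.
  apply/cvg_sup => i V; rewrite nbhsE => -[B [[C oC <-] Cx] BV].
  have [n nP] := JP i; exists n => // m /= nm; apply: BV => /=.
  by have [ym _] := yP m; rewrite ym; [exact: Cx|exact: nP].
move=> /(_ _ xU)[n _ /(_ n (leqnn n))].
by have [_] := yP n.
Qed.

End DiscreteProduct.

Lemma continuous_coord (U : topologicalType) (J : eqType) (L : topologicalType)
  (F : U -> {ptws J -> L}) :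
  (forall j, continuous (fun u => F u j)) -> continuous F.
Proof.
move=> cF x; apply/cvg_sup.
move=> j V; rewrite nbhsE => -[B [[C oC <-] Cx] BV].
have nC : nbhs (F x j) C by rewrite nbhsE; exists C.
have H : nbhs x ((fun u => F u j) @^-1` C) by exact: (cF j x _ nC).
suff : nbhs x (F @^-1` V) by [].
by apply: filterS H => y Cy; apply: BV.
Qed.

Lemma ptws_continuous (I J : eqType) (K L : choiceType)
  (F : {ptws I -> discrete_topology K} -> {ptws J -> discrete_topology L}) :
  (forall x j, exists s : seq I, forall y, (forall i, i \in s -> y i = x i) ->
     F y j = F x j) ->
  continuous F.
Proof.
move=> HF; apply: continuous_coord => j x V VF.
have [s sP] := HF x j; suff : nbhs x ((fun u => F u j) @^-1` V) by [].
apply: filterS (nbhs_agree x s) => y yx.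
by rewrite /= (sP y yx); apply: nbhs_singleton.
Qed.

Lemma compact_paths (R : finType) (b : nat) :
  compact [set e : {ptws nat -> discrete_topology (R * nat)%type} |
    forall n, ((e n).2 <= b)%N].
Proof.
apply: (@tychonoff nat (fun=> discrete_topology (R * nat)%type)
  (fun=> [set x : R * nat | (x.2 <= b)%N])) => _.
apply: finite_compact.
have -> : [set x : R * nat | (x.2 <= b)%N] = [set: R] `*` `I_b.+1.
  by apply/seteqP; split => x /=; [split|case].
by apply: finite_setX; [exact: finite_finset|exact: finite_II].
Qed.

Lemma closed_agree (I : eqType) (K : choiceType)
  (P : set {ptws I -> discrete_topology K}) :
  (forall x, (forall s : seq I, exists2 y, P y & forall i, i \in s ->
    y i = x i) -> P x) ->
  closed P.
Proof.
move=> HP x cx; apply: HP => s.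
by have [y [Py ys]] := cx _ (nbhs_agree x s); exists y.
Qed.

(** The preimage of a closed set under [h] is the image under [F] of a compact set, hence closed. *)
Lemma graph_continuous (U X Y : topologicalType) (K : set U)
  (F : U -> X) (G : U -> Y) (SX : set X) (SY : set Y) (h : SX -> SY) :
  compact K -> continuous F -> continuous G -> hausdorff_space X ->
  (forall x : SX, exists2 u, K u & F u = set_val x) ->
  (forall u (x : SX), K u -> F u = set_val x -> G u = set_val (h x)) ->
  continuous h.
Proof.
move=> cK cF cG hX surj hP; apply/continuous_closedP => C.
rewrite -[closed C]openC => -[C' oC' eC].
have clC' : closed (~` C') by rewrite closedC.
have cpt : compact (F @` (K `&` G @^-1` (~` C'))).
  apply: continuous_compact; first exact: continuous_subspaceT.
  by apply: compact_closedI => //; move/continuous_closedP : cG; apply.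
have clF := compact_closed hX cpt.
have -> : h @^-1` C = set_val @^-1` (F @` (K `&` G @^-1` (~` C'))).
  apply/seteqP; split => x /=.
  - move=> Chx; have [u Ku Fu] := surj x; exists u => //; split=> //= C'G.
    have : (~` C) (h x) by rewrite -eC /=; rewrite -(hP u x).
    exact.
  - move=> [u [Ku C'G] Fu]; apply: contrapT => nC; apply: C'G => /=.
    have : (~` C) (h x) by [].
    by rewrite -eC /= (hP u x).
have /continuous_closedP := @initial_continuous SX X set_val; exact.
Qed.

(** Two continuous maps from one compact set into Hausdorff spaces with the same fibres have
    homeomorphic images; continuity of an inverse coding need not be checked by hand. *)
Lemma graph_homeomorphism (U X Y : topologicalType) (K : set U)
  (F : U -> X) (G : U -> Y) (SX : set X) (SY : set Y) :
  compact K -> continuous F -> continuous G ->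
  hausdorff_space X -> hausdorff_space Y ->
  F @` K = SX -> G @` K = SY ->
  (forall u v, K u -> K v -> F u = F v <-> G u = G v) ->
  exists h : SX -> SY, homeomorphism h /\
    forall u (x : SX), K u -> F u = set_val x -> G u = set_val (h x).
Proof.
move=> cK cF cG hX hY FK GK FG.
have surjF (x : SX) : exists2 u, K u & F u = set_val x.
  have imF v : SX v -> exists2 u, K u & F u = v by rewrite -FK.
  exact/imF/set_mem/valP.
have surjG (y : SY) : exists2 u, K u & G u = set_val y.
  have imG v : SY v -> exists2 u, K u & G u = v by rewrite -GK.
  exact/imG/set_mem/valP.
have /choice[h hP] : forall x : SX, exists y : SY,
    forall u, K u -> F u = set_val x -> G u = set_val y.
  move=> x; have [u Ku Fu] := surjF x.
  have Gu : G u \in SY by rewrite inE -GK; exists u.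
  by exists (exist _ (G u) Gu) => v Kv Fv /=; apply/FG => //; rewrite Fv.
have /choice[g gP] : forall y : SY, exists x : SX,
    forall u, K u -> G u = set_val y -> F u = set_val x.
  move=> y; have [u Ku Gu] := surjG y.
  have Fu : F u \in SX by rewrite inE -FK; exists u.
  by exists (exist _ (F u) Fu) => v Kv Gv /=; apply/FG => //; rewrite Gv.
exists h; split; last by move=> u x; apply: hP.
exists g; split.
- move=> x; apply: val_inj; have [u Ku Fu] := surjF x.
  exact: etrans (esym (gP _ u Ku (hP x u Ku Fu))) Fu.
- move=> y; apply: val_inj; have [u Ku Gu] := surjG y.
  exact: etrans (esym (hP _ u Ku (gP y u Ku Gu))) Gu.
- by apply: (graph_continuous cK cF cG) => // u x; apply: hP.
- by apply: (graph_continuous cK cG cF) => // u x; apply: gP.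
Qed.

Definition centered (n : nat) : seq int :=
  [seq (k%:Z - n%:Z)%R | k <- iota 0 (n + n).+1].

Lemma mem_centered n i : (i \in centered n) = (absz i <= n)%N.
Proof.
apply/mapP/idP => [[k]|iN].
  by rewrite mem_iota => kn ->; lia.
by exists (absz (i + n%:Z)%R); [rewrite mem_iota; lia|lia].
Qed.

Lemma centered_cover i : exists n, forall m, (n <= m)%N -> i \in centered m.
Proof. by exists (absz i) => m; rewrite mem_centered. Qed.

Section PathModel.
Context {R A : finType} (tau : R -> seq R) (al be : R) (theta : R ->
  seq A) (a0 : A).
Context (Htau : full tau al be).
Context (theta0 : forall r, (0 < size (theta r))%N).

Local Notation U := {ptws nat -> discrete_topology (R * nat)%type}.
Local Notation X := {ptws int -> discrete_topology A}.

Definition paths : set U := [set e | edge_path tau theta e].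

Definition coded : set X := [set x | forall t n,
  codelang tau theta (window x t n)].

Lemma eq_left_word_agree e e' n : (forall m, (m <= n)%N -> e m = e' m) ->
  left_word tau e n = left_word tau e' n.
Proof.
by elim: n => //= n IH ee; rewrite ee // IH // => m mn; apply/ee/leqW.
Qed.

Lemma eq_right_word_agree e e' n : (forall m, (m <= n)%N -> e m = e' m) ->
  right_word tau e n = right_word tau e' n.
Proof.
by elim: n => //= n IH ee; rewrite ee // IH // => m mn; apply/ee/leqW.
Qed.

Lemma point_agree e (j : int) : exists n, forall e' : nat -> R * nat,
  (forall m, (m <= n)%N -> e' m = e m) ->
  path_point tau al be theta a0 e' j = path_point tau al be theta a0 e j.
Proof.
exists (absz j).+1 => e' ee; rewrite /path_point /glue_words.
case: j ee => j /= ee.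
  by rewrite /right_half ee // (eq_right_word_agree ee).
by rewrite /left_half ee // (@eq_left_word_agree e' e j.+1) // => m mj;
  apply: ee; lia.
Qed.

Lemma compact_path_space : compact paths.
Proof.
pose b := (\max_r size (tau r) + \max_r size (theta r))%N.
apply: subclosed_compact (@compact_paths R b) _.
- apply: closed_agree => x xP; split.
    have [y [lt _] yx] := xP [:: 0].
    by rewrite -yx // mem_head.
  move=> n; have [y [_ /(_ n)[lt e]] yx] := xP [:: n; n.+1].
  have yn : y n = x n by apply: yx; rewrite !inE eqxx.
  have yn1 : y n.+1 = x n.+1 by apply: yx; rewrite !inE eqxx orbT.
  by rewrite -yn1 -yn.
- move=> e [lt pe] [|n] /=.
    apply: leq_trans (ltnW lt) _; rewrite /b.
    apply: leq_trans (leq_addl _ _); exact: (leq_bigmax (e 0).1).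
  have [/ltnW ltn _] := pe n; apply: leq_trans ltn _; rewrite /b.
  apply: leq_trans (leq_addr _ _); exact: (leq_bigmax (e n.+1).1).
Qed.

Lemma continuous_point (g : (nat -> R * nat) -> nat -> R * nat) :
  (forall e n, exists m, forall e', (forall k, (k <= m)%N -> e' k = e k) ->
     forall k, (k <= n)%N -> g e' k = g e k) ->
  continuous ((fun e => path_point tau al be theta a0 (g e)) : U -> X).
Proof.
move=> gP; apply: ptws_continuous => e j.
have [n nP] := point_agree (g e) j; have [m mP] := gP e n.
exists (iota 0 m.+1) => e' ee; apply: nP => k kn.
by apply: mP kn => i im; apply: ee; rewrite mem_iota.
Qed.

(** The image is compact, hence closed, and by [path_approx] it meets every cylinder around a point
    of [coded]. *)
Lemma image_paths :
  (fun e : U => path_point tau al be theta a0 e : X) @` paths = coded.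
Proof.
pose F : U -> X := path_point tau al be theta a0.
rewrite -[X in X @` _]/F.
have cF : continuous F by apply: (@continuous_point id) => e n;
  exists n => e' ee.
have cpt : compact (F @` paths).
  by apply: continuous_compact compact_path_space; apply: continuous_subspaceT.
have clF := compact_closed (@ptws_hausdorff int A) cpt.
apply/seteqP; split=> [_ [e pe <-]|x xX].
  by move=> t n; apply: point_codelang.
apply: clF => V /(nbhs_coord centered_cover)[n nV].
have [e pe ee] := path_approx Htau a0 theta0 n xX.
exists (F e); split; first by exists e.
apply: nV => i; rewrite mem_centered => iN.
have := congr1 (fun w => nth a0 w (absz (i + n%:Z)%R)) ee.
rewrite !nth_mkseq; [|lia..].
by have -> : (- n%:Z + (absz (i + n%:Z))%:Z = i)%R by lia.
Qed.

End PathModel.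

Lemma val_iterz (A : finType) (sigma : substitution A) (x : subst_system sigma)
  n :
  set_val (iterz n x) = shiftby n (set_val x) :> (int -> A).
Proof.
have fwdE k : set_val (iter k (@fwd (subst_system sigma)) x) = shiftby k%:Z
  (set_val x) :> (int -> A).
  elim: k => [|k IH]; first by apply: funext => i; rewrite /shiftby addr0.
  rewrite iterS; apply: funext => i.
  transitivity (set_val (iter k (@fwd (subst_system sigma)) x) (i + 1)%R) => //.
  by rewrite IH /shiftby; congr (set_val x _); lia.
have bwdE k : set_val (iter k (@bwd (subst_system sigma)) x) = shiftby (-
  k%:Z)%R (set_val x) :> (int -> A).
  elim: k => [|k IH]; first by apply: funext => i; rewrite /shiftby addr0.
  rewrite iterS; apply: funext => i.
  transitivity (set_val (iter k (@bwd (subst_system sigma)) x) (i + -1)%R) =>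
    //.
  by rewrite IH /shiftby; congr (set_val x _); lia.
by case: n => k; rewrite /iterz ?fwdE ?bwdE // NegzE.
Qed.

Lemma orbP (A : finType) (sigma : substitution A) (x y : subst_system sigma) :
  orb x y <-> same_orbit (set_val x : int -> A) (set_val y).
Proof.
split=> [[n _ <-]|[d e]]; first by exists n; apply: val_iterz.
by exists d => //; apply: val_inj; apply: etrans (val_iterz x d) (esym e).
Qed.

Lemma subst_shift_coded (A R : finType) (sigma : substitution A)
  (tau : R -> seq R) (theta : R -> seq A) :
  (forall w, itlang sigma w <-> codelang tau theta w) ->
  subst_shift sigma = coded tau theta.
Proof. by move=> L; apply/seteqP; split=> x xX t n; apply/L/xX. Qed.

(** The maps [F] and [G] read the same path through the two orders of the diagram. Recognizability
    makes both injective, so their images are homeomorphic, and [related] describes the orbits on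
    either side. *)
Lemma edge_perm_orbit_equivalent (R A A' : finType) (tau tau' : R -> seq R)
  (al be : R) (theta : R -> seq A) (theta' : R -> seq A')
  (sigma : substitution A) (zeta : substitution A') :
  full tau al be -> full tau' al be ->
  (forall r, 0 < size (theta r))%N -> (forall r,
    size (theta' r) = size (theta r)) ->
  (forall c, exists s s', [/\ tau c = al :: rcons s be,
     tau' c = al :: rcons s' be & perm_eq s s']) ->
  recognizable tau -> recognizable tau' -> recognizable theta ->
    recognizable theta' ->
  (forall w, itlang sigma w <-> codelang tau theta w) ->
  (forall w, itlang zeta w <-> codelang tau' theta' w) ->
  orbit_equivalent (subst_system sigma) (subst_system zeta).
Proof.
move=> Htau Htau' theta0 sz perm rtau rtau' rtheta rtheta' Ls Lz.
have theta0' r : (0 < size (theta' r))%N by rewrite sz.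
have [rho [rho' [P P']]] := edge_perm_exists perm.
have [a0 _] : exists a0 : A, a0 \in theta al.
  by case: (theta al) (theta0 al) => // a0 w _; exists a0; rewrite mem_head.
have [a0' _] : exists a0 : A', a0 \in theta' al.
  by case: (theta' al) (theta0' al) => // a0' w _; exists a0'; rewrite mem_head.
pose F (e : {ptws nat -> discrete_topology (R * nat)%type}) :
  {ptws int -> discrete_topology A} := path_point tau al be theta a0 e.
pose G (e : {ptws nat -> discrete_topology (R * nat)%type}) :
  {ptws int -> discrete_topology A'} := path_point tau' al be theta' a0'
    (relabel rho e).
have cF : continuous F.
  by apply: (@continuous_point _ _ _ _ _ _ _ id) => e n; exists n => e' ee.
have cG : continuous G.
  apply: continuous_point => e n; exists n => e' ee [|k] kn; rewrite /= ?ee //.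
have relP e : edge_path tau theta e -> edge_path tau' theta' (relabel rho e).
  exact: (relabel_path P sz).
have relP' e : edge_path tau' theta' e -> edge_path tau theta (relabel rho' e).
  by apply: (relabel_path P') => r; rewrite sz.
have injF e e' : edge_path tau theta e -> edge_path tau theta e' ->
  F e = F e' -> e = e'.
  exact: (point_inj Htau theta0 rtheta rtau).
have injG e e' : edge_path tau theta e -> edge_path tau theta e' ->
  G e = G e' -> e = e'.
  move=> pe pe' ee; have [_ pa] := pe; have [_ pa'] := pe'.
  rewrite -[e](relabelK P pa) -[e'](relabelK P pa'); congr relabel.
  by apply: (point_inj Htau' theta0' rtheta' rtau' (relP _ pe) (relP _ pe') ee).
have FK : F @` paths tau theta = subst_shift sigma.
  by rewrite (subst_shift_coded Ls); apply: image_paths.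
have GK : G @` paths tau theta = subst_shift zeta.
  rewrite (subst_shift_coded Lz) -(image_paths a0' Htau' theta0').
  apply/seteqP; split=> _ [e pe <-]; first by exists (relabel rho e) => //;
    apply: relP.
  exists (relabel rho' e); first exact: relP'.
  by rewrite /G (relabelK P') //; case: pe.
have [|h [homeo hP]] := graph_homeomorphism (@compact_path_space _ _ tau theta)
  cF cG
  (@ptws_hausdorff int A) (@ptws_hausdorff int A') FK GK.
  by move=> u v pu pv; split=> [/(injF _ _ pu pv)->|/(injG _ _ pu pv)->].
exists h; split=> // x.
have surj (y : subst_system sigma) : exists2 e,
  paths tau theta e & F e = set_val y.
  have im v : subst_shift sigma v -> exists2 e,
    paths tau theta e & F e = v by rewrite -FK.
  exact/im/set_mem/valP.
have orbits (y z : subst_system sigma) : same_orbit (set_val y : int ->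
  A) (set_val z) <->
    same_orbit (set_val (h y) : int -> A') (set_val (h z)).
  have [e pe ey] := surj y; have [e' pe' ez] := surj z.
  rewrite -(hP e y pe ey) -(hP e' z pe' ez) -ey -ez; have [_ pa] := pe;
    have [_ pa'] := pe'.
  have injG' f f' : edge_path tau' theta' f -> edge_path tau' theta' f' ->
      path_point tau' al be theta' a0' f = path_point tau' al be theta' a0' f'
        -> f = f'.
    exact: (point_inj Htau' theta0' rtheta' rtau').
  apply: (iff_trans (orbit_related Htau theta0 injF pe pe')).
  apply: iff_trans; last first.
    exact: iff_sym (orbit_related Htau' theta0' injG' (relP _ pe) (relP _ pe')).
  split; first by apply: (relabel_related P).
  have [_ qa] := relP _ pe; have [_ qa'] := relP _ pe'.
  by move=> /(relabel_related P' qa qa'); rewrite (relabelK P pa) (relabelK P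
    pa').
have [g [hg gh _ _]] := homeo.
apply/seteqP; split=> y.
- move=> [z /orbP xz <-]; apply/orbP; exact/orbits.
- move=> /orbP hxy; exists (g y); last exact: gh.
  by apply/orbP/orbits; rewrite gh.
Qed.

(** * Orbit equivalence and powers *)

Lemma val_itlang (A : finType) (sigma : substitution A) (x : subst_system
  sigma) t n :
  itlang sigma (window (set_val x : int -> A) t n).
Proof. by have xP : subst_shift sigma (set_val x) := set_mem (valP x);
  apply: xP. Qed.

Section Cantor.
Context {A : finType} (sigma : substitution A).
Context (sigma_cantor : cantor_set (subst_system sigma)).

Lemma cantor_compact : compact [set: subst_system sigma].
Proof.
have [h [g [hg gh _ cg]]] := sigma_cantor.
have -> : [set: subst_system sigma] = g @` [set: cantor_space].
  by apply/seteqP; split=> // x _; exists (h x).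
apply: continuous_compact cantor_space_compact.
exact: continuous_subspaceT.
Qed.

(** If [p] were a period of the whole language, [p] letters would determine a point and the subshift
    would be finite. *)
Lemma cantor_aperiodic a p : (0 < p)%N ->
  exists2 v, itlang sigma v & size v = p.+1 /\ nth a v 0 != nth a v p.
Proof.
move=> p0; apply: contrapT => H.
have per (x : subst_system sigma) i : set_val x (i + p%:Z)%R = set_val x i.
  apply: contrapT => /eqP ne; apply: H.
  exists (window (set_val x : int -> A) i p.+1).
    exact: val_itlang.
  rewrite size_window !nth_mkseq // addr0; split=> //.
  by rewrite eq_sym.
have perM (x : subst_system sigma) i k : set_val x (i + (k * p)%N%:Z)%R =
  set_val x i.
  elim: k => [|k IH]; first by rewrite addr0.
  by rewrite mulSn addnC PoszD addrA per IH.
have det (x y : subst_system sigma) :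
    (forall i : 'I_p, set_val x (i : nat)%:Z%R = set_val y (i : nat)%:Z%R) -> x
      = y.
  move=> xy; apply: val_inj; apply: funext => i.
  have main j : (0 <= j)%R -> set_val x j = set_val y j.
    case: j => // n _; rewrite (divn_eq n p) addnC PoszD !perM.
    exact: (xy (Ordinal (ltn_pmod n p0))).
  have := main (i + (absz i * p)%N%:Z)%R; rewrite !perM; apply.
  by nia.
have [h [g [hg gh _ _]]] := sigma_cantor.
(* One more point of the Cantor space is taken than there are [p]-tuples of letters. *)
pose N := #|{: p.-tuple A}|.
pose pt (n : 'I_N.+1) : cantor_space := fun m => m == n.
pose w (n : 'I_N.+1) : p.-tuple A :=
  [tuple set_val (g (pt n)) (i : nat)%:Z%R | i < p].
have winj : injective w.
  move=> m n e; have eg : g (pt m) = g (pt n).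
    apply: det => i; have := congr1 (fun t : p.-tuple A => tnth t i) e.
    by rewrite !tnth_mktuple.
  have := congr1 h eg; rewrite !gh => /(congr1 (fun f : nat -> bool => f m)).
  by rewrite /pt eqxx => /esym/eqP mn; apply: val_inj.
by have := leq_card w winj; rewrite card_ord ltnn.
Qed.

Lemma cantor_letter : exists a : A, True.
Proof.
have [h [g _]] := sigma_cantor.
by exists (set_val (g (fun=> true)) 0%R).
Qed.

End Cantor.

(** * Full powers of proper primitive substitutions *)

Section ProperPower.
Context {A : finType} (sigma : substitution A).
Context (sigma_proper : proper_subst sigma).
Context (sigma_primitive : primitive_subst sigma).

Lemma subst_neq0 w : w != [::] -> mor sigma w != [::].
Proof.
case: w => // c w _; rewrite mor_cons -size_eq0 size_cat.
by have := image_word_neq0 sigma c; rewrite -size_eq0; lia.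
Qed.

Lemma itmor_subst_neq0 n w : w != [::] -> itmor sigma n w != [::].
Proof. by move=> w0; elim: n => // n IH; rewrite itmorS subst_neq0. Qed.

Lemma proper_power : exists (m : nat) (a b : A), forall k w, (m <= k)%N ->
  w != [::] ->
  [/\ forall d, d \in itmor sigma k w, prefix [:: a] (itmor sigma k w) &
      suffix [:: b] (itmor sigma k w)].
Proof.
have [n1 prim] := sigma_primitive; have [n2 [a [b [_ prop]]]] := sigma_proper.
exists (n1 + n2)%N, a, b => k w mk w0; split.
- move=> d; have -> : k = (n1 + (k - n1))%N by lia.
  rewrite itmor_add; have := itmor_subst_neq0 (k - n1) w0;
    case: (itmor sigma (k - n1) w) => // c u _.
  by rewrite -cat1s itmor_cat mem_cat prim.
- have -> : k = (n2 + (k - n2))%N by lia.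
  rewrite itmor_add; have := itmor_subst_neq0 (k - n2) w0;
    case: (itmor sigma (k - n2) w) => // c u _.
  by rewrite -[c :: u]cat1s itmor_cat; apply: prefix_catl; have [] := prop c.
- have -> : k = (n2 + (k - n2))%N by lia.
  rewrite itmor_add; have := itmor_subst_neq0 (k - n2) w0;
    case/lastP: (itmor sigma (k - n2) w) => // u c _.
  by rewrite -cats1 itmor_cat; apply: suffix_catr; have [] := prop c.
Qed.

Lemma full_power : (exists c d : A, c != d) ->
  exists (f : A -> seq A) (a b : A), full f a b /\
    forall w, itlang f w <-> itlang sigma w.
Proof.
move=> [c0 [d0 cd]]; have [m [a [b mP]]] := proper_power.
have size2 w : w != [::] -> (size w <= 1)%N ->
  itmor sigma m w != [::] /\ (1 < size (itmor sigma m w))%N.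
  move=> w0 _; have [all_ _ _] := mP m w (leqnn m) w0.
  split; first exact: itmor_subst_neq0.
  have := all_ c0; have := all_ d0; case: itmor => // x [|//].
  by rewrite !inE => /eqP e1 /eqP e2; rewrite e1 e2 eqxx in cd.
have size_m w : (size w * 2 <= size (itmor sigma m w))%N.
  rewrite itmor_mor; apply: size_mor_ge => c.
  by have [//|_] := size2 [:: c] isT.
(* The inner [m + m] iterations produce at least three letters. Under the outer [m], the first
   letter yields the initial [a], the middle ones yield all letters, and the last one yields the
   final [b]. *)
pose e := (m + (m + m))%N; exists (fun c => itmor sigma e [:: c]), a, b; split.
- move=> c; rewrite /e itmor_add; set w := itmor sigma (m + m) [:: c].
  have : (2 < size w)%N.
    have := size_m (itmor sigma m [:: c]); have := size_m [:: c].
    by rewrite -itmor_add -/w /=; lia.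
  case: w => // c1 w; case/lastP: w => // w c3; case: w => // c2 w _.
  have -> : c1 :: rcons (c2 :: w) c3 = [:: c1] ++ (c2 :: w) ++ [:: c3].
    by rewrite cats1.
  rewrite !itmor_cat.
  have [_ /prefixP[s1 ->] _] := mP m [:: c1] (leqnn m) isT.
  have [_ _ /suffixP[s3 ->]] := mP m [:: c3] (leqnn m) isT.
  have [all_ _ _] := mP m (c2 :: w) (leqnn m) isT.
  exists (s1 ++ itmor sigma m (c2 :: w) ++ s3); split.
    by rewrite -cats1 -!catA.
  by move=> d; rewrite !mem_cat all_ orbT.
- have itE n w : itmor (fun c => itmor sigma e [:: c]) n w = itmor sigma (n *
  e) w.
    elim: n => // n IH; rewrite itmorS IH mulSn itmor_add.
    by rewrite [RHS]itmor_mor.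
  move=> w; split=> -[n [c wc]].
    by exists (n * e)%N, c; rewrite -itE.
  exists (n + m).+1, c; rewrite itE; apply: infix_trans wc _.
  have [k ek] : exists k, ((n + m).+1 * e = n + (m + k))%N.
    have [e0|e0] := posnP e; last by exists ((n + m).+1 * e - (n + m))%N; nia.
    have m0 : m = 0 by rewrite /e in e0; lia.
    have [all_ _ _] := mP 0 [:: c0] (eq_leq m0) isT.
    by have := all_ d0; rewrite inE eq_sym (negPf cd).
  rewrite ek itmor_add; apply: infix_itmor.
  have [all_ _ _] := mP (m + k)%N [:: c] (leq_addr _ _) isT.
  have /splitPr cs := all_ c.
  by case: _ / cs => s1 s2; exact: (infix_infix s1 [:: c] s2).
Qed.

End ProperPower.

Lemma cantor_full_power (A : finType) (sigma : substitution A) :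
  proper_subst sigma -> primitive_subst sigma ->
    cantor_set (subst_system sigma) ->
  exists (f : A -> seq A) (a b : A), [/\ full f a b,
    forall w, itlang f w <-> itlang sigma w &
    forall p, (0 < p)%N ->
      exists2 v, itlang f v & size v = p.+1 /\ nth a v 0 != nth a v p].
Proof.
move=> pr pm ca; have [a0 _] := cantor_letter ca.
have [v _ [_ v01]] := cantor_aperiodic ca a0 (ltn0Sn 0).
have [|f [a [b [Hf L]]]] := full_power pr pm.
  by exists (nth a0 v 0), (nth a0 v 1).
exists f, a, b; split=> // p p0; have [u uL uP] := cantor_aperiodic ca a p0.
by exists u => //; apply/L.
Qed.

(* Quantifying over all finite-valued observables, instead of fixing the
   coordinate map, makes invariance under isomorphism immediate. *)
Definition powers (S : system) N :=
  forall (T : finType) (f : S -> discrete_topology T), continuous f -> forall m,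
    exists p x, (m < p)%N /\
      forall i, (i < N * p)%N -> f (iter (i + p) (@fwd S) x) = f (iter i (@fwd
        S) x).

Lemma powers_leq S M N : (M <= N)%N -> powers S N -> powers S M.
Proof.
move=> MN SN T f cf m; have [p [x [mp xP]]] := SN T f cf m.
exists p, x; split=> // i iM; apply: xP; apply: leq_trans iM _.
by rewrite leq_mul2r MN orbT.
Qed.

Lemma powers_isomorphic S S' N : isomorphic S S' -> powers S N -> powers S' N.
Proof.
move=> [h [[g [hg gh ch cg]] hT]] SN T f cf m.
have [|p [x [mp xP]]] := SN T (f \o h) _ m.
  by move=> x; apply: continuous_comp; [exact: ch|exact: cf].
have hiter i : h (iter i (@fwd S) x) = iter i (@fwd S') (h x).
  by elim: i => //= i IH; rewrite hT IH.
by exists p, (h x); split=> // i iN; have := xP i iN; rewrite /= !hiter.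
Qed.

Lemma isomorphic_sym S S' : isomorphic S S' -> isomorphic S' S.
Proof.
move=> [h [[g [hg gh ch cg]] hT]]; exists g; split; first by exists h; split.
by move=> y; rewrite -{1}[y]gh -hT hg.
Qed.

(** For the coordinate at 0 as observable, [powers] would give a word of the language with period
    [p] and length [N * p], against [power_bound]. *)
Lemma powers_bounded (A : finType) (zeta : substitution A) :
  proper_subst zeta -> primitive_subst zeta -> cantor_set (subst_system zeta) ->
  exists N, ~ powers (subst_system zeta) N.
Proof.
move=> pr pm ca; have [f [a [b [Hf L aper]]]] := cantor_full_power pr pm ca.
have [N HN] := power_bound Hf aper; exists N => SN.
have c0 : continuous ((fun x => set_val x 0%R) : subst_system zeta ->
  discrete_topology A).
  move=> x.
  apply: (@continuous_comp _ _ _ (set_val : subst_shift zeta -> _)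
    (@proj int (fun=> discrete_topology A) 0%R)).
    exact: initial_continuous.
  exact: proj_continuous.
have [p [x [p0 xP]]] := SN A _ c0 0.
pose w := window (set_val x : int -> A) 0%R (N * p).
suff : (size w < N * p)%N by rewrite size_window ltnn.
apply: (HN p w p0).
  exact/L/val_itlang.
rewrite size_window => i ip; rewrite !nth_mkseq; [|lia..].
have := xP i; have := val_iterz x (Posz i); have := val_iterz x (Posz (i + p)).
rewrite /= => -> -> /(_ _); rewrite /shiftby !add0r; apply; lia.
Qed.

(** Each point has a radius that works near it; compactness gives a common one. *)
Lemma uniform_window (A T : finType) (zeta : substitution A)
  (f : subst_system zeta -> discrete_topology T) :
  cantor_set (subst_system zeta) -> continuous f ->
  exists r : nat, forall x y : subst_system zeta,
    (forall i, (absz i <= r)%N -> set_val x i = set_val y i) -> f x = f y.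
Proof.
move=> ca cf; have /compact_near_coveringP cov := cantor_compact ca.
pose X := {ptws int -> discrete_topology A}.
pose P (r : nat) (x : subst_system zeta) := forall y : subst_system zeta,
  (forall i, (absz i <= r)%N -> set_val x i = set_val y i) -> f x = f y.
have vc : continuous (set_val : subst_shift zeta -> X).
  exact: initial_continuous.
have [|r _ rP] := cov nat \oo P _; last first.
  by exists r => x y; apply: (rP r (leqnn r) x).
move=> x _.
have nf : nbhs x [set y | f y = f x].
  have := cf x [set f x]; apply; rewrite nbhs_principalE.
  exact/principal_filterP.
have [V nV VP] : exists2 V : set X, nbhs (set_val x : X) V &
    forall y : subst_system zeta, V (set_val y) -> f y = f x.
  case: nf => B [[V oV <-] Vx] BV; exists V; last by move=> y Vy; apply: BV.
  by rewrite nbhsE; exists V.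
have [n nP] := nbhs_coord centered_cover nV.
have near_x : nbhs x [set y : subst_system zeta |
    forall i, i \in centered n -> set_val y i = set_val x i].
  exact: (vc x _ (nbhs_agree (set_val x : X) (centered n))).
exists ([set y : subst_system zeta |
    forall i, i \in centered n -> set_val y i = set_val x i],
      [set r | (n <= r)%N]) => /=.
  by split=> //; exists n.
move=> [y r] [/= yx nr] z yz.
have fy : f y = f x by apply: VP; apply: nP.
rewrite fy; apply/esym/VP/nP => i iN; rewrite -yx //; apply/esym/yz.
by move: iN; rewrite mem_centered => /leq_trans; apply.
Qed.

Lemma codelang_extend (R A : eqType) (tau : R -> seq R) (al be : R)
  (theta : R -> seq A) w : full tau al be -> (forall r,
    (0 < size (theta r))%N) ->
  w != [::] -> codelang tau theta w -> exists x : int -> A,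
    (forall t n, codelang tau theta (window x t n)) /\ occurs x 0%R w.
Proof.
move=> Htau theta0 w0 [n [c /infixP[u [v ew]]]].
have [a0 _] : exists a0 : A, a0 \in theta al.
  by case: (theta al) (theta0 al) => // a0 s _; exists a0; rewrite mem_head.
have [e pe ec] := path_through Htau theta0 c n.
have [|e' [pe' _ ec' pte']] := path_rebuild Htau theta0 (t := size u) (n :=
  n) pe.
  by rewrite ec ew !size_cat; move: w0; rewrite -size_eq0; lia.
exists (path_point tau al be theta a0 e'); split.
  by move=> t k; apply: point_codelang.
have := occurs_pointer Htau a0 theta0 n pe'; rewrite ec' ec ew pte' =>
  /occurs_sub.
by rewrite addNr.
Qed.

Lemma nth_repeat (A : Type) (a0 : A) M u i : (i + size u < M * size u)%N ->
  nth a0 (flatten (nseq M u)) (i + size u) = nth a0 (flatten (nseq M u)) i.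
Proof.
case: M => [|M] //; have comm : u ++ flatten (nseq M u) = flatten (nseq M u) ++
  u.
  by elim: M => [|M IH] /=; rewrite ?cats0 // {1}IH catA.
have szM : size (flatten (nseq M u)) = (M * size u)%N.
  by elim: (M) => //= k IH; rewrite size_cat IH.
rewrite mulSn addnC ltn_add2l => iM.
by rewrite /= nth_cat ltnNge leq_addr /= addKn comm nth_cat szM iM.
Qed.

(** Of the [M] periods, one is lost by comparing a position with its translate, and one to the width
    of the window on which [f] depends. *)
Lemma powers_repetition (R B : finType) (tau : R -> seq R) (al be d c : R)
  (psi : R -> seq B) (zeta : substitution B) M : full tau al be ->
  (forall r, (0 < size (psi r))%N) -> (1 < M)%N ->
  infix (flatten (nseq M [:: al; d])) (tau c) ->
  (forall w, itlang zeta w <-> codelang tau psi w) ->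
  cantor_set (subst_system zeta) -> powers (subst_system zeta) (M - 2).
Proof.
move=> Htau psi0 M2 minf L ca T f cf m.
have [r rP] := uniform_window ca cf.
(* The period becomes longer than both [m] and [r + r]. The point is later shifted by [r], so that
   every window lies inside the power. *)
pose n := (m + (r + r))%N; pose u := mor psi (itmor tau n [:: al; d]).
have nu : (n < size u)%N.
  apply: leq_trans (size_itmor_gt Htau n (w := [:: al; d]) isT) _.
  by have := size_mor_ge (itmor tau n [:: al; d]) psi0; rewrite muln1.
have eW : flatten (nseq M u) = mor psi (itmor tau n (flatten (nseq M [:: al;
  d]))).
  by rewrite [itmor _ _ (flatten _)]itmor_mor !mor_flatten_nseq -itmor_mor.
have szW : size (flatten (nseq M u)) = (M * size u)%N.
  by elim: (M) => //= k IH; rewrite size_cat IH.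
have [||y [yL yW]] := codelang_extend (w := flatten (nseq M u)) Htau psi0.
- by rewrite -size_eq0 szW muln_eq0; lia.
- exists n.+1, c; rewrite eW itmorSr mor1.
  exact/infix_mor/infix_itmor.
have yX : (y : {ptws int -> discrete_topology B}) \in subst_shift zeta.
  by rewrite inE (subst_shift_coded L).
pose Y : subst_system zeta := exist
  (fun z : {ptws int -> discrete_topology B} => is_true (z \in subst_shift
    zeta)) y yX.
exists (size u), (iter r (@fwd (subst_system zeta)) Y).
split; first by apply: leq_ltn_trans nu; rewrite leq_addr.
move=> i iM; rewrite -!iterD; apply: rP => j jr.
have := val_iterz Y (Posz (i + size u + r)); have := val_iterz Y (Posz (i + r)).
rewrite /= => -> ->; rewrite /shiftby.
have [q eq] : exists q, q = absz (j + (i + r)%N%:Z)%R by eexists.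
have -> : (j + (i + r)%N%:Z = 0 + q%:Z)%R by rewrite eq; lia.
have -> : (j + (i + size u + r)%N%:Z = 0 + (q + size u)%N%:Z)%R by rewrite eq;
  lia.
have lt : (q + size u < M * size u)%N.
  have le : (q <= i + (r + r))%N by rewrite eq; lia.
  have ru : (r + r < size u)%N by apply: leq_ltn_trans nu; rewrite leq_addl.
  have -> : (M * size u = (M - 2) * size u + size u + size u)%N.
    by rewrite -addnA addnn -mul2n -mulnDl subnK.
  by move: le ru iM; clear; lia.
have b0 : B by case: u nu {eW szW yW iM lt} => [|b0 u'] // _; exact: b0.
pose W := flatten (nseq M u).
have e1 : y (0 + (q + size u)%N%:Z)%R = nth b0 W (q + size u)%N.
  by apply: (occurs_nth b0 yW); rewrite szW.
have e2 : y (0 + q%:Z)%R = nth b0 W q.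
  by apply: (occurs_nth b0 yW); rewrite szW; apply: leq_ltn_trans lt;
    rewrite leq_addr.
exact: etrans e1 (etrans (nth_repeat b0 lt) (esym e2)).
Qed.

(** * Orbit equivalent subshifts with prescribed powers *)

Section OrbitEquivalentFamily.
Context {A : finType} (sigma : substitution A).
Context (sigma_proper : proper_subst sigma).
Context (sigma_primitive : primitive_subst sigma).
Context (sigma_cantor : cantor_set (subst_system sigma)).

Lemma orbit_equivalent_cantor (B : finType) (zeta : substitution B) :
  orbit_equivalent (subst_system sigma) (subst_system zeta) ->
  cantor_set (subst_system zeta).
Proof.
move=> [h [[g [hg gh ch cg]] _]]; have [k [k' [kk' k'k ck ck']]] :=
  sigma_cantor.
exists (k \o g), (h \o k'); split.
- by move=> y /=; rewrite kk' gh.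
- by move=> c /=; rewrite hg k'k.
- by move=> y; apply: continuous_comp; [exact: cg|exact: ck].
- by move=> c; apply: continuous_comp; [exact: ck'|exact: ch].
Qed.

Lemma orbit_equivalent_with_powers N : exists (B : finType) (zeta :
  substitution B),
  [/\ proper_subst zeta, primitive_subst zeta, cantor_set (subst_system zeta),
      orbit_equivalent (subst_system sigma) (subst_system zeta) &
      powers (subst_system zeta) N].
Proof.
have [f [a [b [Hf Lf aper]]]] :=
  cantor_full_power sigma_proper sigma_primitive sigma_cantor.
have [R [theta [ul [ur [theta_inj theta_irred two HQ]]]]] :=
  derived_substitution Hf aper.
have theta0 r : (0 < size (theta r))%N.
  by have [+ _ _] := theta_irred r; rewrite -size_eq0 lt0n.
(* Two periods are lost in [powers_repetition]. *)
pose M := N.+2; pose H := \max_r size (theta r).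
(* The first three summands serve the rearrangement; [H] makes every image at least as long as its
   column is high, as the tower requires. *)
have [tau [al [be [ul' [ur' [Htau Hcount tau_inj tau_irred Lt]]]]]] :=
  HQ (M.*2 + #|R| + 7 + H)%N.
have [d dx] := two al.
have Hcount' c z : (M.*2 + #|R| + 7 <= count_mem z (tau c))%N.
  by apply: leq_trans (Hcount c z); rewrite leq_addr.
have [tau' [perm tau'_inj tau'_irred tau'_marker]] :=
  rearrangement (M := M) Htau dx isT Hcount'.
have Htau' : full tau' al be.
  move=> c; have [s [s' [es es' pss']]] := perm c; exists s'; split=> // z.
  rewrite -(perm_mem pss'); have [t [et tP]] := Htau c.
  have -> : s = t by move: et; rewrite es; case=> /rcons_inj [].
  exact: tP.
pose h r := size (theta r).
have htau r : (h r <= size (tau' r))%N.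
  have [s [s' [es es' pss']]] := perm r.
  have -> : size (tau' r) = size (tau r).
    by rewrite es es' /= !size_rcons (perm_size pss').
  apply: leq_trans (count_size (pred1 al) (tau r)).
  apply: leq_trans (Hcount r al); apply: leq_trans (leq_addl _ _).
  exact: (leq_bigmax r).
pose zeta := Substitution (tower_subst_neq0 theta0 htau).
have Lz w : itlang zeta w <-> codelang tau' (floors (h := h)) w.
  exact: (tower_codelang Htau' theta0 htau).
have rtheta : recognizable theta.
  apply: (irred_recognizable (g := fun c => [:: c]) (ul := ul) (ur :=
    ur)) => // r.
  by rewrite mor_id.
have rtau : recognizable tau.
  exact: (irred_recognizable tau_irred theta0 tau_inj).
have rtau' : recognizable tau'.
  apply: (irred_recognizable (g := fun c => [:: c]) (ul := [::]) (ur :=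
    marker (x := al) (d := d) (M := M))) => // r.
  by rewrite mor_id.
have rfloors : recognizable (floors (h := h)).
  exact: (irred_recognizable (floors_irred theta0) _ (floors_inj theta0)).
have OE : orbit_equivalent (subst_system sigma) (subst_system zeta).
  apply: (edge_perm_orbit_equivalent Htau Htau' theta0 _ perm rtau rtau' rtheta
    rfloors _ Lz).
    by move=> r; rewrite size_floors.
  by move=> w; apply: iff_trans (Lt w); apply: iff_sym.
have ca := orbit_equivalent_cantor OE.
exists _, zeta; split=> //.
- have [x [y xy]] := tower_boundary Htau' theta0 htau.
  by exists 2, x, y.
- by exists 2 => x y; apply: (tower_mem Htau' theta0 htau).
- have := powers_repetition Htau' _ _ (tau'_marker al) Lz ca; rewrite subn2.
  by apply=> // r; rewrite size_floors.
Qed.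

End OrbitEquivalentFamily.

Theorem theorem3p3 (A : finType) (sigma : substitution A)
    (sigma_proper : proper_subst sigma)
    (sigma_primitive : primitive_subst sigma)
    (sigma_cantor : cantor_set (subst_system sigma)) :
  exists (B : nat -> finType) (zeta : forall n : nat, substitution (B n)),
    (forall n : nat,
       [/\ proper_subst (zeta n),
           primitive_subst (zeta n),
           cantor_set (subst_system (zeta n)) &
           orbit_equivalent (subst_system sigma) (subst_system (zeta n))]) /\
    (forall m n : nat, m <> n ->
       ~ isomorphic (subst_system (zeta m)) (subst_system (zeta n))).
Proof.
have /choice[g gP] : forall N, exists Bz : {B : finType & substitution B},
    [/\ proper_subst (tagged Bz), primitive_subst (tagged Bz),
        cantor_set (subst_system (tagged Bz)),
        orbit_equivalent (subst_system sigma) (subst_system (tagged Bz)) &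
        powers (subst_system (tagged Bz)) N].
  move=> N; have [B [zeta P]] :=
    orbit_equivalent_with_powers sigma_proper sigma_primitive sigma_cantor N.
  by exists (existT _ B zeta).
have /choice[b bP] : forall N, exists k, ~ powers (subst_system (tagged (g N)))
  k.
  by move=> N; have [pr pm ca _ _] := gP N; apply: powers_bounded.
(* Each index is at least the bound on powers of the preceding system, and by monotonicity of [u] at
   least that of every earlier one. *)
pose u := fix u n := if n is n'.+1 then maxn (u n') (b (u n')) else 0.
have u_mono m n : (m <= n)%N -> (u m <= u n)%N.
  move=> mn; rewrite -(subnKC mn); elim: (n - m)%N => [|k IH];
    first by rewrite addn0.
  by rewrite addnS /= (leq_trans IH) // leq_maxl.
have sep m n : (m < n)%N -> ~ isomorphic (subst_system (tagged (g (u n))))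
    (subst_system (tagged (g (u m)))).
  move=> mn iso; apply: (bP (u m)); apply: powers_isomorphic iso _.
  have [_ _ _ _] := gP (u n); apply: powers_leq.
  by apply: leq_trans (u_mono _ _ mn); rewrite /= leq_maxr.
exists (fun n => tag (g (u n))), (fun n => tagged (g (u n))); split.
  by move=> n; have [] := gP (u n).
move=> m n; case: (ltngtP m n) => // mn _ iso.
- by apply: (sep _ _ mn); apply: isomorphic_sym.
- exact: (sep _ _ mn).
Qed.
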